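(* Let $V\neq0$ be a module in $\mathcal C_{fin}$, with central charges $c_0,c_1,\dots,c_\nu$. Then: (1) If $c_0>0$ and $c_1=c_2=\cdots=c_\nu=0$, then $\{v\in V\mid\tau(B)_+\cdot v=0\}\neq0$. (2) If $c_0<0$ and $c_1=c_2=\cdots=c_\nu=0$, then $\{v\in V\mid\tau(B)_-\cdot v=0\}\neq0$. (3) If $c_0=c_1=\cdots=c_\nu=0$, then there exist non-zero elements $v,w\in V$ such that $(\dot{\mathfrak g}_+\otimes A\otimes B)\cdot v=0$ and $(\dot{\mathfrak g}_-\otimes A\otimes B)\cdot w=0$.
   Context: Let $\dot{\mathfrak g}$ be a finite-dimensional simple Lie algebra over $\mathbb{C}$ with Cartan subalgebra $\dot{\mathfrak h}$, root system $\dot\Delta$, positive/negative roots $\dot\Delta_\pm$, root spaces $\dot{\mathfrak g}_\alpha$, $\dot{\mathfrak g}_\pm=\bigoplus_{\alpha\in\dot\Delta_\pm}\dot{\mathfrak g}_\alpha$, and nondegenerate invariant symmetric bilinear form $(\cdot|\cdot)$. Let $\nu\ge 1$, $A=\mathbb{C}[t_0^{\pm1},\dots,t_\nu^{\pm1}]$, $A_\nu=\mathbb{C}[t_1^{\pm1},\dots,t_\nu^{\pm1}]$; for $\mathbf m=(m_0,\dots,m_\nu)\in\mathbb{Z}^{\nu+1}$ put $t^{\mathbf m}=t_0^{m_0}\cdots t_\nu^{m_\nu}$. Let $d_p=t_p\,\partial/\partial t_p$ and $\mathcal D=\mathrm{Der}A=\bigoplus_{p=0}^\nu A d_p$. Let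 $\mathcal K$ be spanned by symbols $t^{\mathbf m}k_p$ ($0\le p\le\nu$) subject to $\sum_{p=0}^\nu m_p t^{\mathbf m}k_p=0$. The full toroidal Lie algebra is $\tau=(\dot{\mathfrak g}\otimes A)\oplus\mathcal K\oplus\mathcal D$ with brackets: $[x\otimes t^{\mathbf m},y\otimes t^{\mathbf n}]=[x,y]\otimes t^{\mathbf m+\mathbf n}+(x|y)\sum_p m_p t^{\mathbf m+\mathbf n}k_p$; $\mathcal K$ commutes with $\dot{\mathfrak g}\otimes A$ and $\mathcal K$; $[t^{\mathbf m}d_a,x\otimes t^{\mathbf n}]=n_a x\otimes t^{\mathbf m+\mathbf n}$; $[t^{\mathbf m}d_a,t^{\mathbf n}k_b]=n_a t^{\mathbf m+\mathbf n}k_b+\delta_{ab}\sum_p m_p t^{\mathbf m+\mathbf n}k_p$; $[t^{\mathbf m}d_a,t^{\mathbf n}d_b]=n_a t^{\mathbf m+\mathbf n}d_b-m_b t^{\mathbf m+\mathbf n}d_a+\phi(t^{\mathbf m}d_a,t^{\mathbf n}d_b)$, where $\phi$ is a fixed linear combination of $\phi_1(t^{\mathbf m}d_a,t^{\mathbf n}d_b)=-n_am_b\sum_p m_pt^{\mathbf m+\mathbf n}k_p$ and $\phi_2(t^{\mathbf m}d_a,t^{\mathbf n}d_b)=m_an_b\sum_p m_pt^{\mathbf m+\mathbf n}k_p$. $B$ is a finitely generated commutative associative unital $\mathbb{C}$-algebra, $\tau(B)=\tau\otimes B$ with $[x\otimes b,y\otimes b']=[x,y]\otimes bb'$. Let $\mathfrak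 h=\dot{\mathfrak h}\oplus\bigoplus_{i=0}^\nu\mathbb{C}k_i\oplus\bigoplus_{i=0}^\nu\mathbb{C}d_i$, identified with $\mathfrak h\otimes 1$. A $\tau(B)$-module $V$ is integrable if it is the direct sum of its $\mathfrak h$-weight spaces $V_\lambda$ and each $x_\alpha\otimes t^{\mathbf m}\otimes b$ ($\alpha\in\dot\Delta$, $x_\alpha\in\dot{\mathfrak g}_\alpha$) acts locally nilpotently; $\mathcal C_{fin}$ is the category of integrable $\tau(B)$-modules with finite-dimensional weight spaces. The central charges of $V$ are integers $c_i$ such that $\lambda(k_i)=c_i$ for every weight $\lambda$ of $V$, $0\le i\le\nu$ (standing assumption: these are constant on the set of weights). Put $\tau_\pm=(\dot{\mathfrak g}_\pm\otimes A_\nu)\oplus(\dot{\mathfrak g}\otimes I_\pm)\oplus\sum_{i=0}^\nu I_\pm k_i\oplus\sum_{i=0}^\nu I_\pm d_i$, where $I_+=t_0\mathbb{C}[t_0,t_1^{\pm1},\dots,t_\nu^{\pm1}]$ and $I_-=t_0^{-1}\mathbb{C}[t_0^{-1},t_1^{\pm1},\dots,t_\nu^{\pm1}]$; $\tau(B)_\pm=\tau_\pm\otimes B$.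
   Formalization: The form is additionally assumed positive definite on the real span of the coroots (true for positive multiples of the Killing form); for a negative multiple the signs of the central charges flip and parts (1) and (2) fail. *)

(* Defs.v *)
From HB Require Import structures.
From mathcomp Require Import all_boot all_order all_algebra.
From mathcomp Require Import finmap boolp classical_sets reals complex.
From mathcomp.multinomials Require Import monalg.

Set Implicit Arguments.
Unset Strict Implicit.
Unset Printing Implicit Defensive.

Import Order.TTheory GRing.Theory Num.Theory.
Local Open Scope classical_set_scope.
Local Open Scope ring_scope.

Section Span.
Context {F : fieldType} {V : lmodType F}.
Implicit Types (S : set V) (x y : V).

Definition lspan S : set V :=
  [set x | exists2 s : seq (F * V), (forall p, p \in s -> S p.2)
                                  & x = \sum_(p <- s) p.1 *: p.2].

Lemma lspan_gen S x : S x -> lspan S x.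
Proof.
move=> Sx; exists [:: (1, x)]; last by rewrite big_seq1 scale1r.
by move=> p; rewrite inE => /eqP ->.
Qed.

Lemma lspan0 S : lspan S 0.
Proof. by exists [::]; rewrite ?big_nil. Qed.

Lemma lspanD S x y : lspan S x -> lspan S y -> lspan S (x + y).
Proof.
move=> [s Ss ->] [t St ->]; exists (s ++ t); last by rewrite big_cat.
by move=> p; rewrite mem_cat => /orP[/Ss|/St].
Qed.

Lemma lspanZ S a x : lspan S x -> lspan S (a *: x).
Proof.
move=> [s Ss ->]; exists [seq (a * p.1, p.2) | p <- s].
  by move=> _ /mapP[p /Ss Sp ->].
by rewrite big_map scaler_sumr; apply: eq_bigr => p _; rewrite scalerA.
Qed.

Lemma lspan_min S (P : set V) : P 0 -> (forall a x y, P x -> P y -> P (a *: x + y)) ->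
  S `<=` P -> lspan S `<=` P.
Proof.
move=> P0 PL SP x [s Ss ->]; elim: s Ss => [|p s IHs] Ss; first by rewrite big_nil.
rewrite big_cons; apply: PL; first exact/SP/Ss/mem_head.
by apply: IHs => q qs; apply: Ss; rewrite inE qs orbT.
Qed.

End Span.

(* Linear extension of a map defined on the basis of a free vector space. *)
Section LinearExtension.
Context {F : fieldType} {I : choiceType} {X : lmodType F} (f : I -> X).

Definition mext (g : {malg F[I]}) : X := \sum_(i <- msupp g) g@_i *: f i.

Lemma mextEw (d : {fset I}) g : (msupp g `<=` d)%fset ->
  mext g = \sum_(i <- d) g@_i *: f i.
Proof.
move=> le; rewrite /mext (big_fset_incl _ le) => //= i _ /mcoeff_outdom ->.
by rewrite scale0r.
Qed.

Lemma mext_is_linear : linear mext.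
Proof.
move=> a g h; pose d := (msupp g `|` msupp h `|` msupp (a *: g + h))%fset.
rewrite !(@mextEw d) ?fsubsetUr //.
- rewrite scaler_sumr -big_split /=; apply: eq_bigr => i _.
  by rewrite mcoeffD mcoeffZ scalerDl scalerA.
- by rewrite /d -fsetUA fsetUCA fsubsetUl.
- by rewrite /d -fsetUA fsubsetUl.
Qed.

HB.instance Definition _ :=
  GRing.isLinear.Build F {malg F[I]} X *:%R mext mext_is_linear.

Lemma mext1 i : mext << i >> = f i.
Proof.
by rewrite (mextEw msuppU_le) big_seq_fset1 mcoeffUU scale1r.
Qed.

End LinearExtension.

Lemma malg_ind (F : fieldType) (I : choiceType) (P : set {malg F[I]}) :
    P 0 -> (forall a x y, P x -> P y -> P (a *: x + y)) -> (forall i, P << i >>) ->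
  forall x, P x.
Proof.
move=> P0 PL Pi x; rewrite [x]monalgE; elim: (X in \sum_(_ <- X) _) => [|i s IHs].
  by rewrite big_nil.
rewrite big_cons; suff -> : << x@_i *g i >> = x@_i *: << i >> by apply: PL.
by apply/malgP => k; rewrite mcoeffZ !mcoeffU mulr_natr.
Qed.

(* The vector space with generators I and relations Rel. *)
Section Presentation.
Context {F : fieldType} {I : choiceType} (Rel : set {malg F[I]}).

Definition relp : {pred {malg F[I]}} := fun x => `[< lspan Rel x >].

Fact relp_zmod_closed : zmod_closed relp.
Proof.
split=> [|x y /asboolP Rx /asboolP Ry]; apply/asboolP; first exact: lspan0.
by rewrite addrC -scaleN1r; apply: lspanD => //; apply: lspanZ.
Qed.
HB.instance Definition _ := GRing.isZmodClosed.Build _ relp relp_zmod_closed.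

Definition relz : zmodClosed {malg F[I]} := relp.

Definition pres := Quotient.quot relz.
HB.instance Definition _ := GRing.Zmodule.on pres.

Local Notation pi := (\pi_(Quotient.quot relz))%qT.

Lemma pi_eq x y : (pi x = pi y) <-> lspan Rel (x - y).
Proof.
split=> [/eqP|h]; first by rewrite -Quotient.idealrBE => /asboolP.
by apply/eqP; rewrite -Quotient.idealrBE; apply/asboolP.
Qed.

Definition pres_scale (a : F) (q : pres) : pres := pi (a *: repr q).

Fact pres_scale_pi a x : pres_scale a (pi x) = pi (a *: x).
Proof.
by apply/pi_eq; rewrite -scalerBr; apply: lspanZ; apply/pi_eq; rewrite reprK.
Qed.

Lemma pi_surj (q : pres) : exists x, q = pi x.
Proof. by exists (repr q); rewrite reprK. Qed.

Fact pres_scaleA a b v : pres_scale a (pres_scale b v) = pres_scale (a * b) v.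
Proof. by have [x ->] := pi_surj v; rewrite !pres_scale_pi scalerA. Qed.
Fact pres_scale1 : left_id 1 pres_scale.
Proof. by move=> v; have [x ->] := pi_surj v; rewrite pres_scale_pi scale1r. Qed.
Fact pres_scaleDr : right_distributive pres_scale +%R.
Proof.
move=> a u v; have [x ->] := pi_surj u; have [y ->] := pi_surj v.
have piD z t : pi (z + t) = (pi z : pres) + pi t by rewrite raddfD.
by rewrite -piD !pres_scale_pi scalerDr piD.
Qed.
Fact pres_scaleDl v : {morph pres_scale^~ v : a b / a + b}.
Proof.
move=> a b; have [x ->] := pi_surj v.
by rewrite !pres_scale_pi scalerDl raddfD.
Qed.

HB.instance Definition _ := GRing.Zmodule_isLmodule.Build F pres
  pres_scaleA pres_scale1 pres_scaleDr pres_scaleDl.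

Definition gen (i : I) : pres := pi << i >>.

Lemma pi_is_linear : linear (pi : {malg F[I]} -> pres).
Proof. move=> a x y; have -> : a *: (pi x : pres) = pi (a *: x) := pres_scale_pi a x.
by rewrite -raddfD. Qed.
HB.instance Definition _ :=
  GRing.isLinear.Build F {malg F[I]} pres *:%R (pi : {malg F[I]} -> pres) pi_is_linear.

Lemma gen_rel x : Rel x -> mext gen x = 0.
Proof.
move=> Rx; rewrite -[RHS](linear0 (pi : {malg F[I]} -> pres)).
suff -> : mext gen x = pi x by apply/pi_eq; rewrite subr0; exact: lspan_gen.
apply: (malg_ind (P := fun y => mext gen y = pi y)) => [|a y z yE zE|i].
- by rewrite !linear0.
- by rewrite !linearP /= yE zE.
- exact: mext1.
Qed.

Lemma pres_ind (P : set pres) : P 0 ->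
    (forall a x y, P x -> P y -> P (a *: x + y)) -> (forall i, P (gen i)) ->
  forall x, P x.
Proof.
move=> P0 PL Pi x; rewrite -[x]reprK.
apply: (malg_ind (P := fun y => P (pi y))) => [|a y z Py Pz|i].
- by rewrite linear0.
- by rewrite linearP; apply: PL.
- exact: Pi.
Qed.

Context {X : lmodType F} (f : I -> X).

(* Only meaningful when f respects the relations: see pres_map_gen. *)
Definition pres_map (q : pres) : X := mext f (repr q).

Hypothesis f_rel : forall x, Rel x -> mext f x = 0.

Lemma pres_map_pi x : pres_map (pi x) = mext f x.
Proof.
apply/eqP; rewrite -subr_eq0 -linearB /=; apply/eqP.
have : lspan Rel (repr (pi x) - x) by apply/pi_eq; rewrite reprK.
apply: (lspan_min (P := [set y | mext f y = 0])) => //=; first exact: linear0.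
by move=> a y z fy fz; rewrite linearP /= fy fz scaler0 addr0.
Qed.

Lemma pres_map_gen i : pres_map (gen i) = f i.
Proof. by rewrite pres_map_pi mext1. Qed.

Lemma pres_map_linear : linear pres_map.
Proof.
move=> a u v; have [x ->] := pi_surj u; have [y ->] := pi_surj v.
by rewrite -linearP !pres_map_pi linearP.
Qed.

End Presentation.

Definition bilin (F : fieldType) (U V X : lmodType F) (f : U -> V -> X) : Prop :=
  (forall v, linear (f^~ v)) /\ (forall u, linear (f u)).

Section Bilinear.
Context {F : fieldType}.

Lemma mext_bilin (I : choiceType) (U X : lmodType F) (f : I -> U -> X) :
  (forall i, linear (f i)) -> bilin (fun (g : {malg F[I]}) u => mext (f^~ u) g).
Proof.
move=> fL; split=> [u|g]; first exact: mext_is_linear.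
move=> a u v; rewrite /mext scaler_sumr -big_split /=; apply: eq_bigr => i _.
by rewrite fL scalerDr !scalerA mulrC.
Qed.

Lemma pres_map_bilin (I : choiceType) (Rel : set {malg F[I]}) (U X : lmodType F)
    (f : I -> U -> X) :
  (forall i, linear (f i)) -> (forall u x, Rel x -> mext (f^~ u) x = 0) ->
  bilin (fun (q : pres Rel) u => pres_map (f^~ u) q).
Proof.
move=> fL fR; split=> [u|q]; first exact: pres_map_linear (fR u).
exact: (mext_bilin fL).2.
Qed.

Lemma linear_lin (U X : lmodType F) (f : U -> X) : linear f ->
  [/\ f 0 = 0, forall x y, f (x - y) = f x - f y & forall a x, f (a *: x) = a *: f x].
Proof.
move=> fL; pose fl := HB.pack_for {linear U -> X} f (GRing.isLinear.Build F U X *:%R f fL).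
by split=> [|x y|a x]; rewrite -[f]/(fl : U -> X) ?linear0 ?linearB ?linearZ.
Qed.

Lemma lin_sum (U X : lmodType F) (f : U -> X) : linear f ->
  forall (I : Type) (r : seq I) (c : I -> F) (x : I -> U),
  f (\sum_(i <- r) c i *: x i) = \sum_(i <- r) c i *: f (x i).
Proof.
move=> fL I r c x; elim: r => [|i r IHr]; last by rewrite !big_cons fL IHr.
by rewrite !big_nil; have [] := linear_lin fL.
Qed.

Lemma bilinD (U V X : lmodType F) (f h : U -> V -> X) : bilin f -> bilin h ->
  bilin (fun u v => f u v + h u v).
Proof.
by move=> [fl fr] [hl hr]; split=> [v|u] a x y; rewrite ?(fl, hl) ?(fr, hr) addrACA scalerDr.
Qed.

Lemma bilinN (U V X : lmodType F) (f : U -> V -> X) : bilin f -> bilin (fun u v => - f u v).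
Proof. by move=> [fl fr]; split=> [v|u] a x y; rewrite (fl, fr) opprD scalerN. Qed.

Lemma bilinC (U V X : lmodType F) (f : U -> V -> X) : bilin f -> bilin (fun v u => f u v).
Proof. by move=> [fl fr]; split. Qed.

Lemma bilin_comp (U V X U' V' : lmodType F) (f : U -> V -> X) (p : U' -> U) (q : V' -> V) :
  bilin f -> linear p -> linear q -> bilin (fun u v => f (p u) (q v)).
Proof. by move=> [fl fr] pL qL; split=> [v|u] a x y; rewrite (pL, qL) (fl, fr). Qed.

Lemma bilin0l (U V X : lmodType F) (f : U -> V -> X) v : bilin f -> f 0 v = 0.
Proof. by case=> /(_ v)/linear_lin[]. Qed.

Lemma bilin0r (U V X : lmodType F) (f : U -> V -> X) u : bilin f -> f u 0 = 0.
Proof. by case=> _ /(_ u)/linear_lin[]. Qed.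

Lemma dk_sum (X : lmodType F) (I : finType) (k : I -> X) (cm cn : I -> F) (a : I) :
  \sum_p (cm p + cn p) *: k p = 0 ->
  \sum_b cn b *: (cn a *: k b + (a == b)%:R *: \sum_p cm p *: k p) = 0.
Proof.
move=> k0; rewrite (eq_bigr (fun b => cn a *: (cn b *: k b)
    + (cn b * (a == b)%:R) *: \sum_p cm p *: k p)) => [|b _]; last first.
  by rewrite scalerDr !scalerA [cn b * cn a]mulrC.
rewrite big_split -scaler_sumr /= [X in _ + X](bigD1 a) //= eqxx mulr1.
rewrite [X in _ + (_ + X)]big1 => [|b bDa]; last first.
  by rewrite eq_sym (negPf bDa) mulr0 scale0r.
rewrite addr0 -scalerDr -big_split /=.
rewrite (eq_bigr (fun p => (cm p + cn p) *: k p)) ?k0 ?scaler0 // => p _.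
by rewrite -scalerDl addrC.
Qed.

End Bilinear.

Section BracketSums.
Context {X : zmodType}.
Implicit Types a b c d e f z : X.

Lemma br_sum_0 a b c d e f : a = 0 -> b = 0 -> c = 0 -> d = 0 -> e = 0 -> f = 0 ->
  a + (b - c) + (d - e) + f = 0.
Proof. by do 6!move=> ->; rewrite !(subr0, sub0r, addr0, add0r). Qed.

Lemma br_sum_gg a b c d e f z : a = z -> b = 0 -> c = 0 -> d = 0 -> e = 0 -> f = 0 ->
  a + (b - c) + (d - e) + f = z.
Proof. by do 6!move=> ->; rewrite !(subr0, sub0r, addr0, add0r). Qed.

Lemma br_sum_dg a b c d e f z : a = 0 -> b = z -> c = 0 -> d = 0 -> e = 0 -> f = 0 ->
  a + (b - c) + (d - e) + f = z.
Proof. by do 6!move=> ->; rewrite !(subr0, sub0r, addr0, add0r). Qed.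

Lemma br_sum_gd a b c d e f z : a = 0 -> b = 0 -> c = z -> d = 0 -> e = 0 -> f = 0 ->
  a + (b - c) + (d - e) + f = - z.
Proof. by do 6!move=> ->; rewrite !(subr0, sub0r, addr0, add0r). Qed.

Lemma br_sum_dk a b c d e f z : a = 0 -> b = 0 -> c = 0 -> d = z -> e = 0 -> f = 0 ->
  a + (b - c) + (d - e) + f = z.
Proof. by do 6!move=> ->; rewrite !(subr0, sub0r, addr0, add0r). Qed.

Lemma br_sum_kd a b c d e f z : a = 0 -> b = 0 -> c = 0 -> d = 0 -> e = z -> f = 0 ->
  a + (b - c) + (d - e) + f = - z.
Proof. by do 6!move=> ->; rewrite !(subr0, sub0r, addr0, add0r). Qed.

Lemma br_sum_dd a b c d e f z : a = 0 -> b = 0 -> c = 0 -> d = 0 -> e = 0 -> f = z ->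
  a + (b - c) + (d - e) + f = z.
Proof. by do 6!move=> ->; rewrite !(subr0, sub0r, addr0, add0r). Qed.

End BracketSums.

Section Tensor.
Context {F : fieldType} (U W : lmodType F).

Definition tensor_rel : set {malg F[(U * W)%type]} :=
  [set r | (exists a u u' w,
              r = << (a *: u + u', w) >> - (a *: << (u, w) >> + << (u', w) >>))
        \/ (exists a u w w',
              r = << (u, a *: w + w') >> - (a *: << (u, w) >> + << (u, w') >>))].

Definition tensor := pres tensor_rel.
HB.instance Definition _ := GRing.Lmodule.on tensor.

Definition tens (u : U) (w : W) : tensor := gen tensor_rel (u, w).

Definition tlift (X : lmodType F) (f : U -> W -> X) : tensor -> X :=
  pres_map (fun p => f p.1 p.2).

Lemma tensor_ind (P : set tensor) : P 0 ->
    (forall a x y, P x -> P y -> P (a *: x + y)) -> (forall u w, P (tens u w)) ->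
  forall x, P x.
Proof. by move=> P0 PL Pt; apply: pres_ind => // -[u w]; apply: Pt. Qed.

Lemma bilin_rel (X : lmodType F) (f : U -> W -> X) : bilin f ->
  forall x, tensor_rel x -> mext (fun p => f p.1 p.2) x = 0.
Proof.
move=> [fl fr] _ [] [a [u [w [w' ->]]]]; rewrite linearB linearP /= !mext1 /=.
  by rewrite fl subrr.
by rewrite fr subrr.
Qed.

Lemma tlift_tens (X : lmodType F) (f : U -> W -> X) : bilin f ->
  forall u w, tlift f (tens u w) = f u w.
Proof. by move=> /bilin_rel fR u w; rewrite /tlift pres_map_gen. Qed.

Lemma tlift_linear (X : lmodType F) (f : U -> W -> X) : bilin f -> linear (tlift f).
Proof. by move=> /bilin_rel; apply: pres_map_linear. Qed.

Lemma tlift_bilin (Y X : lmodType F) (f : U -> W -> Y -> X) :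
  (forall u w, linear (f u w)) -> (forall y, bilin (fun u w => f u w y)) ->
  bilin (fun t y => tlift (fun u w => f u w y) t).
Proof.
move=> fY fB; apply: (pres_map_bilin (f := fun p y => f p.1 p.2 y)) => [[u w]|y].
  exact: fY.
exact: (bilin_rel (fB y)).
Qed.

Lemma tens_bilin : bilin tens.
Proof.
split=> [w a u u'|u a w w'].
  have /gen_rel : tensor_rel (<< (a *: u + u', w) >> - (a *: << (u, w) >> + << (u', w) >>)).
    by left; exists a, u, u', w.
  by rewrite linearB linearP /= !mext1 => /eqP; rewrite subr_eq0 => /eqP.
have /gen_rel : tensor_rel (<< (u, a *: w + w') >> - (a *: << (u, w) >> + << (u, w') >>)).
  by right; exists a, u, w, w'.
by rewrite linearB linearP /= !mext1 => /eqP; rewrite subr_eq0 => /eqP.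
Qed.

End Tensor.

Section LieAlgebra.
Context {F : fieldType}.

Definition is_lie (L : lmodType F) (br : L -> L -> L) : Prop :=
  [/\ bilin br, forall x, br x x = 0
    & forall x y z, br x (br y z) + br y (br z x) + br z (br x y) = 0].

Definition is_lie_module (L V : lmodType F) (br : L -> L -> L) (rho : L -> V -> V) : Prop :=
  bilin rho /\ forall x y v, rho (br x y) v = rho x (rho y v) - rho y (rho x v).

End LieAlgebra.

(* The multi-indices (m_0, ..., m_nu). *)
Notation zlat nu := {ffun 'I_nu.+1 -> int}.

Section Toroidal.
Context {F : fieldType} (g : vectType F) (nu : nat).

Local Notation zlat := (zlat nu).

(* The Laurent polynomials as a vector space, << m >> standing for t^m. *)
Definition laurent := {malg F[zlat]}.
HB.instance Definition _ := GRing.Lmodule.on laurent.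

Definition kspace_rel : set {malg F[(zlat * 'I_nu.+1)%type]} :=
  [set r | exists m : zlat, r = \sum_p (m p)%:~R *: << (m, p) >>].
Definition kspace := pres kspace_rel.
HB.instance Definition _ := GRing.Lmodule.on kspace.

(* << (m, p) >> stands for t^m d_p. *)
Definition dspace := {malg F[(zlat * 'I_nu.+1)%type]}.
HB.instance Definition _ := GRing.Lmodule.on dspace.

Definition tau := (tensor g laurent * kspace * dspace)%type.
HB.instance Definition _ := GRing.Lmodule.on tau.

(* x (x) f, t^m k_p and t^m d_p. *)
Definition gA (x : g) (f : laurent) : tau := (tens x f, 0, 0).
Definition gt (x : g) (m : zlat) : tau := gA x << m >>.
Definition kt (m : zlat) (p : 'I_nu.+1) : tau := (0, gen kspace_rel (m, p), 0).
Definition dt (m : zlat) (p : 'I_nu.+1) : tau := (0, 0, << (m, p) >>).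

(* \sum_p m_p t^(m+n) k_p *)
Definition kdiff (m n : zlat) : tau := \sum_p (m p)%:~R *: kt (m + n) p.

Lemma tau_eq (u v : tau) : u.1.1 = v.1.1 -> u.1.2 = v.1.2 -> u.2 = v.2 -> u = v.
Proof. by case: u => [[? ?] ?]; case: v => [[? ?] ?] /= -> -> ->. Qed.

Lemma gA_bilin : bilin gA.
Proof.
have [tl tr] := tens_bilin g laurent.
by split=> [f a x y|x a f h]; apply: tau_eq; rewrite /= ?tl ?tr ?scaler0 ?addr0.
Qed.

Lemma gt_linear m : linear (gt^~ m).
Proof. exact: gA_bilin.1. Qed.

Lemma kt_rel (m : zlat) : \sum_p (m p)%:~R *: kt m p = 0.
Proof.
have /gen_rel : kspace_rel (\sum_p (m p)%:~R *: << (m, p) >>) by exists m.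
rewrite (lin_sum (mext_is_linear _)) => k0.
have kL : linear (fun k : kspace => (0, k, 0) : tau).
  by move=> a x y; apply: tau_eq; rewrite //= ?scaler0 ?addr0.
transitivity ((0, \sum_p (m p)%:~R *: gen kspace_rel (m, p), 0) : tau).
  exact/esym/(lin_sum kL).
have -> : \sum_p (m p)%:~R *: gen kspace_rel (m, p) = 0; last by [].
by rewrite -[RHS]k0; apply: eq_bigr => p _; rewrite mext1.
Qed.

Lemma tau_ind (P : set tau) : P 0 -> (forall a x y, P x -> P y -> P (a *: x + y)) ->
    (forall x m, P (gt x m)) -> (forall m p, P (kt m p)) -> (forall m p, P (dt m p)) ->
  forall u, P u.
Proof.
move=> P0 PL Pg Pk Pd [[u k] d].
have PD x y : P x -> P y -> P (x + y) by move=> Px Py; rewrite -[x]scale1r; apply: PL.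
have -> : (u, k, d) = ((u, 0, 0) : tau) + ((0, k, 0) + (0, 0, d)).
  by apply: tau_eq; rewrite /= ?addr0 ?add0r.
have [PLu PLk PLd] : [/\ forall a u v, P (u, 0, 0) -> P (v, 0, 0) -> P (a *: u + v, 0, 0),
    forall a u v, P (0, u, 0) -> P (0, v, 0) -> P (0, a *: u + v, 0)
    & forall a u v, P (0, 0, u) -> P (0, 0, v) -> P (0, 0, a *: u + v)].
  by split=> a x y Px Py; move: (PL a _ _ Px Py);
     congr P; apply: tau_eq; rewrite /= ?scaler0 ?addr0.
apply: (PD); [|apply: PD].
- apply: (tensor_ind (P := fun u => P (u, 0, 0))) => // x f.
  apply: (malg_ind (P := fun f => P (gA x f))) => [|a f1 f2 Pf1 Pf2|m]; last exact: Pg.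
    by have [-> _ _] := linear_lin (gA_bilin.2 x).
  by rewrite gA_bilin.2; apply: PL.
- by apply: (pres_ind (P := fun k => P (0, k, 0))) => // -[m p]; apply: Pk.
- by apply: (malg_ind (P := fun d => P (0, 0, d))) => // -[m p]; apply: Pd.
Qed.

Section Bracket.
Variables (br : g -> g -> g) (form : g -> g -> F^o) (mu1 mu2 : F).

(* [x (x) t^m, y (x) t^n] *)
Definition gg_br (x y : g) (m n : zlat) : tau :=
  gt (br x y) (m + n) + form x y *: kdiff m n.

(* [t^m d_a, x (x) t^n] *)
Definition dg_br (m : zlat) (a : 'I_nu.+1) (x : g) (n : zlat) : tau :=
  (n a)%:~R *: gt x (m + n).

(* [t^m d_a, t^n k_b] *)
Definition dk_br (m : zlat) (a : 'I_nu.+1) (n : zlat) (b : 'I_nu.+1) : tau :=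
  (n a)%:~R *: kt (m + n) b + (a == b)%:R *: kdiff m n.

(* mu1 * phi_1 + mu2 * phi_2 *)
Definition cocycle (m : zlat) (a : 'I_nu.+1) (n : zlat) (b : 'I_nu.+1) : tau :=
  mu1 *: (- ((n a)%:~R * (m b)%:~R) *: kdiff m n)
  + mu2 *: (((m a)%:~R * (n b)%:~R) *: kdiff m n).

(* [t^m d_a, t^n d_b] *)
Definition dd_br (m : zlat) (a : 'I_nu.+1) (n : zlat) (b : 'I_nu.+1) : tau :=
  (n a)%:~R *: dt (m + n) b - (m b)%:~R *: dt (m + n) a + cocycle m a n b.

Definition gg_ext (u v : tensor g laurent) : tau :=
  tlift (fun x f => tlift (fun y h =>
    mext (fun m => mext (fun n => gg_br x y m n) h) f) v) u.
Definition dg_ext (d : dspace) (u : tensor g laurent) : tau :=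
  mext (fun ma => tlift (fun x f => mext (dg_br ma.1 ma.2 x) f) u) d.
Definition dk_ext (d : dspace) (k : kspace) : tau :=
  mext (fun ma => pres_map (fun nb => dk_br ma.1 ma.2 nb.1 nb.2) k) d.
Definition dd_ext (d d' : dspace) : tau :=
  mext (fun ma => mext (fun nb => dd_br ma.1 ma.2 nb.1 nb.2) d') d.

Definition tau_br (u v : tau) : tau :=
  gg_ext u.1.1 v.1.1 + (dg_ext u.2 v.1.1 - dg_ext v.2 u.1.1)
  + (dk_ext u.2 v.1.2 - dk_ext v.2 u.1.2) + dd_ext u.2 v.2.

Hypotheses (br_bilin : bilin br) (form_bilin : bilin form).

Lemma gg_br_bilin m n : bilin (fun x y => gg_br x y m n).
Proof.
have [bl brr] := br_bilin; have [fl fr] := form_bilin.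
split=> [y a x x'|x a y y']; rewrite /gg_br ?bl ?brr ?fl ?fr gt_linear.
  by rewrite scalerDl scalerDr scalerA addrACA.
by rewrite scalerDl scalerDr scalerA addrACA.
Qed.

Lemma mext_lin2 (I : choiceType) (U X : lmodType F) (f : I -> U -> X) h :
  (forall i, linear (f i)) -> linear (fun u => mext (f^~ u) h).
Proof. by move=> fL; apply: (mext_bilin fL).2. Qed.

Lemma tlift_lin2 (U W Y X : lmodType F) (f : U -> W -> Y -> X) t :
  (forall u w, linear (f u w)) -> linear (fun y => tlift (fun u w => f u w y) t).
Proof. by move=> fL; apply: (mext_lin2 (f := fun p y => f p.1 p.2 y)). Qed.

Lemma gg_ext2_bilin x f : bilin (fun y (h : laurent) =>
  mext (fun m => mext (fun n => gg_br x y m n) h) (f : laurent)).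
Proof.
split=> [h|y].
  apply: (mext_lin2 (f := fun m y => mext (fun n => gg_br x y m n) h)) => m.
  by apply: (mext_lin2 (f := fun n y => gg_br x y m n)) => n; apply: (gg_br_bilin m n).2.
apply: (mext_lin2 (f := fun m h => mext (fun n => gg_br x y m n) h)) => m.
exact: mext_is_linear.
Qed.

Lemma gg_ext1_bilin v : bilin (fun x (f : laurent) => tlift (fun y (h : laurent) =>
  mext (fun m => mext (fun n => gg_br x y m n) h) f) v).
Proof.
split=> [f|x].
  apply: (tlift_lin2 (f := fun y (h : laurent) x =>
    mext (fun m => mext (fun n => gg_br x y m n) h) f)) => y h.
  apply: (mext_lin2 (f := fun m x => mext (fun n => gg_br x y m n) h)) => m.
  by apply: (mext_lin2 (f := fun n x => gg_br x y m n)) => n; apply: (gg_br_bilin m n).1.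
apply: (tlift_lin2 (f := fun y (h f : laurent) =>
    mext (fun m => mext (fun n => gg_br x y m n) h) f)) => y h.
exact: mext_is_linear.
Qed.

Lemma gg_ext_bilin : bilin gg_ext.
Proof.
apply: tlift_bilin => [x f|v]; last exact: gg_ext1_bilin.
exact/tlift_linear/gg_ext2_bilin.
Qed.

Lemma gg_ext_gen x y m n : gg_ext (tens x << m >>) (tens y << n >>) = gg_br x y m n.
Proof.
rewrite /gg_ext (tlift_tens (gg_ext1_bilin _)) (tlift_tens (gg_ext2_bilin _ _)).
by rewrite !mext1.
Qed.

Lemma dg_ext1_bilin m a : bilin (fun x (f : laurent) => mext (dg_br m a x) f).
Proof.
split=> [f|x]; last exact: mext_is_linear.
apply: (mext_lin2 (f := fun n x => dg_br m a x n)) => n c x y.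
by rewrite /dg_br gt_linear scalerDr !scalerA mulrC.
Qed.

Lemma dg_ext_bilin : bilin dg_ext.
Proof.
apply: (mext_bilin (f := fun ma u =>
  tlift (fun x (f : laurent) => mext (dg_br ma.1 ma.2 x) f) u)) => ma.
exact/tlift_linear/dg_ext1_bilin.
Qed.

Lemma dg_ext_gen m a x n : dg_ext << (m, a) >> (tens x << n >>) = dg_br m a x n.
Proof. by rewrite /dg_ext mext1 (tlift_tens (dg_ext1_bilin _ _)) mext1. Qed.

Lemma dk_rel m a x : kspace_rel x -> mext (fun nb => dk_br m a nb.1 nb.2) x = 0.
Proof.
move=> [n ->]; rewrite (lin_sum (mext_is_linear _)).
transitivity (\sum_p (n p)%:~R *: dk_br m a n p).
  by apply: eq_bigr => p _; rewrite mext1.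
apply: (dk_sum (k := kt (m + n)) (cm := fun p => (m p)%:~R) (cn := fun p => (n p)%:~R)).
by rewrite -[RHS](kt_rel (m + n)); apply: eq_bigr => p _; rewrite ffunE intrD.
Qed.

Lemma dk_ext_bilin : bilin dk_ext.
Proof.
apply: (mext_bilin (f := fun ma k => pres_map (fun nb => dk_br ma.1 ma.2 nb.1 nb.2) k)) => ma.
exact/pres_map_linear/dk_rel.
Qed.

Lemma dk_ext_gen m a n b : dk_ext << (m, a) >> (gen kspace_rel (n, b)) = dk_br m a n b.
Proof. by rewrite /dk_ext mext1 (pres_map_gen (@dk_rel _ _)). Qed.

Lemma dd_ext_bilin : bilin dd_ext.
Proof. by apply: mext_bilin => ma; apply: mext_is_linear. Qed.

Lemma dd_ext_gen m a n b : dd_ext << (m, a) >> << (n, b) >> = dd_br m a n b.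
Proof. by rewrite /dd_ext !mext1. Qed.

Lemma tau_br_bilin : bilin tau_br.
Proof.
have L1 : linear (fun u : tau => u.1.1) by move=> a [[? ?] ?] [[? ?] ?]; reflexivity.
have L2 : linear (fun u : tau => u.1.2) by move=> a [[? ?] ?] [[? ?] ?]; reflexivity.
have L3 : linear (fun u : tau => u.2) by move=> a [[? ?] ?] [[? ?] ?]; reflexivity.
apply: bilinD; last exact: (bilin_comp dd_ext_bilin L3 L3).
apply: bilinD; [apply: bilinD|]; first exact: (bilin_comp gg_ext_bilin L1 L1).
  apply: bilinD; first exact: (bilin_comp dg_ext_bilin L3 L1).
  exact/bilinN/bilinC/(bilin_comp dg_ext_bilin L3 L1).
apply: bilinD; first exact: (bilin_comp dk_ext_bilin L3 L2).
exact/bilinN/bilinC/(bilin_comp dk_ext_bilin L3 L2).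
Qed.

Let gg0l v := bilin0l v gg_ext_bilin.
Let gg0r u := bilin0r u gg_ext_bilin.
Let dg0l v := bilin0l v dg_ext_bilin.
Let dg0r u := bilin0r u dg_ext_bilin.
Let dk0l v := bilin0l v dk_ext_bilin.
Let dk0r u := bilin0r u dk_ext_bilin.
Let dd0l v := bilin0l v dd_ext_bilin.
Let dd0r u := bilin0r u dd_ext_bilin.

Lemma tau_br_gg x y m n :
  tau_br (gt x m) (gt y n) =
  gt (br x y) (m + n) + form x y *: \sum_p (m p)%:~R *: kt (m + n) p.
Proof. by apply: br_sum_gg; [exact: gg_ext_gen|exact: dg0l|exact: dg0l|exact: dk0l|exact: dk0l|exact: dd0l]. Qed.

Lemma tau_br_gk x m n p : tau_br (gt x m) (kt n p) = 0.
Proof. by apply: br_sum_0; [exact: gg0r|exact: dg0l|exact: dg0l|exact: dk0l|exact: dk0l|exact: dd0l]. Qed.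

Lemma tau_br_kg x m n p : tau_br (kt n p) (gt x m) = 0.
Proof. by apply: br_sum_0; [exact: gg0l|exact: dg0l|exact: dg0l|exact: dk0l|exact: dk0l|exact: dd0l]. Qed.

Lemma tau_br_kk m p n q : tau_br (kt m p) (kt n q) = 0.
Proof. by apply: br_sum_0; [exact: gg0l|exact: dg0l|exact: dg0l|exact: dk0l|exact: dk0l|exact: dd0l]. Qed.

Lemma tau_br_dg (m n : zlat) a x :
  tau_br (dt m a) (gt x n) = (n a)%:~R *: gt x (m + n).
Proof. by apply: br_sum_dg; [exact: gg0l|exact: dg_ext_gen|exact: dg0l|exact: dk0r|exact: dk0l|exact: dd0r]. Qed.

Lemma tau_br_gd (m n : zlat) a x :
  tau_br (gt x n) (dt m a) = - ((n a)%:~R *: gt x (m + n)).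
Proof. by apply: br_sum_gd; [exact: gg0r|exact: dg0l|exact: dg_ext_gen|exact: dk0l|exact: dk0r|exact: dd0l]. Qed.

Lemma tau_br_dk (m n : zlat) a b :
  tau_br (dt m a) (kt n b) =
  (n a)%:~R *: kt (m + n) b + (a == b)%:R *: \sum_p (m p)%:~R *: kt (m + n) p.
Proof. by apply: br_sum_dk; [exact: gg0l|exact: dg0r|exact: dg0l|exact: dk_ext_gen|exact: dk0l|exact: dd0r]. Qed.

Lemma tau_br_kd (m n : zlat) a b :
  tau_br (kt n b) (dt m a) =
  - ((n a)%:~R *: kt (m + n) b + (a == b)%:R *: \sum_p (m p)%:~R *: kt (m + n) p).
Proof. by apply: br_sum_kd; [exact: gg0l|exact: dg0l|exact: dg0r|exact: dk0l|exact: dk_ext_gen|exact: dd0l]. Qed.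

Lemma tau_br_dd (m n : zlat) a b :
  tau_br (dt m a) (dt n b) =
  (n a)%:~R *: dt (m + n) b - (m b)%:~R *: dt (m + n) a
  + (mu1 *: (- ((n a)%:~R * (m b)%:~R) *: \sum_p (m p)%:~R *: kt (m + n) p)
     + mu2 *: (((m a)%:~R * (n b)%:~R) *: \sum_p (m p)%:~R *: kt (m + n) p)).
Proof. by apply: br_sum_dd; [exact: gg0l|exact: dg0r|exact: dg0r|exact: dk0r|exact: dk0r|exact: dd_ext_gen]. Qed.

End Bracket.
End Toroidal.

(* The current algebra L (x) B of an algebra L with bracket br. *)
Section ScalarExtension.
Context {F : fieldType} (L : lmodType F) (B : comAlgType F).

Definition current_br (br : L -> L -> L) (u v : tensor L B) : tensor L B :=
  tlift (fun x b => tlift (fun y b' => tens (br x y) (b * b')) v) u.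

Lemma current_br_tens (br : L -> L -> L) x b y b' : bilin br ->
  current_br br (tens x b) (tens y b') = tens (br x y) (b * b').
Proof.
move=> [brl brr]; have [tl tr] := tens_bilin L B.
have in_bilin x1 b1 : bilin (fun y b' => tens (br x1 y) (b1 * b') : tensor L B).
  split=> [c|z] a u v; first by rewrite brr tl.
  by rewrite mulrDr -scalerAr tr.
rewrite /current_br tlift_tens ?tlift_tens //; split=> [c|z].
  apply: (tlift_lin2 (f := fun y b' x => tens (br x y) (c * b'))) => y1 b1 a u v.
  by rewrite brl tl.
apply: (tlift_lin2 (f := fun y b' c => tens (br z y) (c * b'))) => y1 b1 a u v.
by rewrite mulrDl -scalerAl tr.
Qed.

Lemma current_br_bilin (br : L -> L -> L) : bilin br -> bilin (current_br br).
Proof.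
move=> [brl brr]; have [tl tr] := tens_bilin L B.
have in_bilin x1 b1 : bilin (fun y b' => tens (br x1 y) (b1 * b') : tensor L B).
  split=> [c|z] a u v; first by rewrite brr tl.
  by rewrite mulrDr -scalerAr tr.
apply: tlift_bilin => [x b|v]; first exact: tlift_linear.
split=> [c|z].
  apply: (tlift_lin2 (f := fun y b' x => tens (br x y) (c * b'))) => y1 b1 a u w.
  by rewrite brl tl.
apply: (tlift_lin2 (f := fun y b' c => tens (br z y) (c * b'))) => y1 b1 a u w.
by rewrite mulrDl -scalerAl tr.
Qed.

(* S (x) B inside L (x) B. *)
Definition current_sub (S : set L) : set (tensor L B) :=
  lspan [set u | exists x b, S x /\ u = tens x b].

Definition fin_gen : Prop :=
  exists s : seq B, forall S : {pred B}, GRing.subalg_closed S ->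
    {subset s <= S} -> forall b, b \in S.

End ScalarExtension.

Section SimpleLieAlgebra.
Context {F : fieldType} (g : vectType F) (br : g -> g -> g).

Definition is_simple : Prop :=
  is_lie br /\ (exists x y, br x y != 0) /\
  forall I : {vspace g}, (forall x y, y \in I -> br x y \in I) ->
    I = 0%VS \/ I = fullv.

Definition ad_diagonalizable (h : g) : Prop :=
  exists2 e : seq g, basis_of fullv e & forall x, x \in e -> exists a, br h x = a *: x.

(* Cartan subalgebras of a semisimple Lie algebra over an algebraically closed
   field of characteristic 0 (Hall, Lie Groups, Lie Algebras, and
   Representations, Definition 7.10). *)
Definition is_cartan (hd : {vspace g}) : Prop :=
  [/\ forall h h', h \in hd -> h' \in hd -> br h h' = 0,
      forall x, (forall h, h \in hd -> br h x = 0) -> x \in hd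
    & forall h, h \in hd -> ad_diagonalizable h].

Variable hd : {vspace g}.

Definition hdual := 'Hom(subvs_of hd, F^o).

Definition root_space (al : hdual) : set g :=
  [set x | forall h : subvs_of hd, br (vsval h) x = al h *: x].

Definition is_root (al : hdual) : Prop :=
  al != 0 /\ exists2 x, root_space al x & x != 0.

Definition nat_comb (Pi : seq hdual) (al : hdual) : Prop :=
  exists c : hdual -> nat, al = \sum_(p <- Pi) p *+ c p.

(* Pi is a system of simple roots. *)
Definition is_base (Pi : seq hdual) : Prop :=
  [/\ free Pi, forall al, al \in Pi -> is_root al
    & forall al, is_root al -> nat_comb Pi al \/ nat_comb Pi (- al)].

Definition g_plus (Pi : seq hdual) : set g :=
  lspan [set x | exists al, [/\ is_root al, nat_comb Pi al & root_space al x]].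

Definition g_minus (Pi : seq hdual) : set g :=
  lspan [set x | exists al, [/\ is_root al, nat_comb Pi (- al) & root_space al x]].

Definition is_invariant_form (form : g -> g -> F^o) : Prop :=
  [/\ bilin form, forall x y, form x y = form y x,
      forall x y z, form (br x y) z = form x (br y z)
    & forall x, (forall y, form x y = 0) -> x = 0].

End SimpleLieAlgebra.

(* The form is positive definite on the real span of the coroots. The central
   elements k_p scale with the form, so this fixes the sign of the central
   charges; the usual normalisation, in which long roots have square length 2,
   is a special case. *)
Definition is_positive_form (F : numFieldType) (g : vectType F) (br : g -> g -> g)
    (hd : {vspace g}) (form : g -> g -> F^o) : Prop :=
  forall h : subvs_of hd, h != 0 ->
    (forall al : hdual hd, is_root br al -> (al h : F) \is Num.real) ->
    (0 : F) < form (vsval h) (vsval h).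

Section TriangularParts.
Context {F : fieldType} (g : vectType F) (nu : nat).

Definition tau_half (n : set g) (half : pred int) : set (tau g nu) :=
  lspan [set u | [\/ exists x (m : zlat nu), [/\ n x, m ord0 = 0 & u = gt x m],
                     exists x (m : zlat nu), half (m ord0) /\ u = gt x m,
                     exists (m : zlat nu) p, half (m ord0) /\ u = kt g m p
                   | exists (m : zlat nu) p, half (m ord0) /\ u = dt g m p]].

Definition tau_plus (n : set g) := tau_half n (fun z => 0 < z).
Definition tau_minus (n : set g) := tau_half n (fun z => z < 0).

(* n (x) A *)
Definition loop_sub (n : set g) : set (tau g nu) :=
  lspan [set u | exists x f, n x /\ u = gA x f].

End TriangularParts.

Section IntegrableModules.
Context {F : fieldType} (g : vectType F) (br : g -> g -> g) (hd : {vspace g}).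
Context (nu : nat) (B : comAlgType F).

Definition cartan := (subvs_of hd * 'rV[F]_nu.+1 * 'rV[F]_nu.+1)%type.

Definition cartan_emb (h : cartan) : tau g nu :=
  gt (vsval h.1.1) 0 + \sum_p h.1.2 0 p *: kt g 0 p + \sum_p h.2 0 p *: dt g 0 p.

Definition cartan_k (p : 'I_nu.+1) : cartan := (0, delta_mx 0 p, 0).

Definition weight := 'Hom(cartan, F^o).

Context (V : lmodType F) (rho : tensor (tau g nu) B -> V -> V).

Definition weight_space (lam : weight) : set V :=
  [set v | forall h : cartan, rho (tens (cartan_emb h) 1) v = lam h *: v].

Definition is_weight (lam : weight) : Prop := exists2 v, weight_space lam v & v != 0.

Definition is_direct_sum (I : eqType) (W : I -> set V) : Prop :=
  (forall v, exists (s : seq I) (f : I -> V),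
     [/\ uniq s, forall i, W i (f i) & v = \sum_(i <- s) f i]) /\
  (forall (s : seq I) (f : I -> V), uniq s -> (forall i, W i (f i)) ->
     \sum_(i <- s) f i = 0 -> forall i, i \in s -> f i = 0).

Definition locally_nilpotent (f : V -> V) : Prop := forall v, exists n, iter n f v = 0.

Definition fin_dim (W : set V) : Prop :=
  exists s : seq V, W `<=` lspan [set` s].

Definition integrable : Prop :=
  is_direct_sum weight_space /\
  forall (al : hdual hd) x (m : zlat nu) (b : B),
    is_root br al -> root_space br al x -> locally_nilpotent (rho (tens (gt x m) b)).

Definition in_Cfin (form : g -> g -> F^o) (mu1 mu2 : F) : Prop :=
  [/\ is_lie_module (current_br (tau_br br form mu1 mu2)) rho,
      integrable & forall lam, fin_dim (weight_space lam)].

Definition central_charges (c : 'I_nu.+1 -> int) : Prop :=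
  forall lam, is_weight lam -> forall p, lam (cartan_k p) = (c p)%:~R.

Definition annihilated (S : set (tensor (tau g nu) B)) (v : V) : Prop :=
  forall u, S u -> rho u v = 0.

End IntegrableModules.

(* Main.v *)
(* Let ell m = \sum_p m_p c_p, and let x, y, h be an sl_2-triple of a root al, so that
   k = (x|y) > 0. If mu(h) + k ell(m) >= -1 on the weight space V_mu, then x (x) t^m maps V_mu
   onto the weight space of mu + al + m; hence occurring weights propagate downwards along real
   roots. As x (x) t^m is nilpotent on the finite-dimensional V_mu, some weight mu + J(al + m)
   does not occur, and propagation through al and -al then bounds ell(n) over the occurring
   weights mu + n, for each mu in the dual of the Cartan subalgebra of g. Subtracting roots al
   with mu(al^vee) >= 2 decreases the length of mu and ends at one of finitely many minuscule
   weights, so the bound is uniform in mu and a top level L is attained. On level L the same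
   descent, with steps in ker ell, places every weight one root above a weight of U(g) V_lam for
   a fixed minuscule weight space V_lam; by Poincare-Birkhoff-Witt and local nilpotency these are
   finitely many. A weight of maximal height on level L is annihilated by everything required.
   The three cases differ only in the sign of ell and in the choice of positive roots. *)

Require Import Defs.
From HB Require Import structures.
From mathcomp Require Import all_boot all_order all_algebra.
From mathcomp Require Import boolp classical_sets reals complex ring.

Set Implicit Arguments.
Unset Strict Implicit.
Unset Printing Implicit Defensive.

Import Order.TTheory GRing.Theory Num.Theory.
Local Open Scope classical_set_scope.
Local Open Scope ring_scope.

(** * Linear maps and their iterates *)

Lemma iter_linear (F : fieldType) (M : lmodType F) (e : M -> M) :
  linear e -> forall k, linear (iter k e).
Proof. by move=> eL; elim=> [|k IHk] a x y //=; rewrite IHk eL. Qed.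

Lemma linear_zero (F : fieldType) (M N : lmodType F) (e : M -> N) : linear e -> e 0 = 0.
Proof. by case/linear_lin. Qed.

Lemma linear_sub (F : fieldType) (M N : lmodType F) (e : M -> N) x y :
  linear e -> e (x - y) = e x - e y.
Proof. by case/linear_lin. Qed.

Lemma linear_scale (F : fieldType) (M N : lmodType F) (e : M -> N) a x :
  linear e -> e (a *: x) = a *: e x.
Proof. by case/linear_lin. Qed.

Lemma linear_add (F : fieldType) (M N : lmodType F) (e : M -> N) x y :
  linear e -> e (x + y) = e x + e y.
Proof. by move=> eL; rewrite -[x]scale1r eL !scale1r. Qed.

Lemma linear_opp (F : fieldType) (M N : lmodType F) (e : M -> N) x : linear e -> e (- x) = - e x.
Proof. by move=> eL; rewrite -scaleN1r linear_scale // scaleN1r. Qed.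

Lemma linear_sumE (F : fieldType) (M N : lmodType F) (e : M -> N) I (r : seq I) (P : pred I)
    (f : I -> M) :
  linear e -> e (\sum_(i <- r | P i) f i) = \sum_(i <- r | P i) e (f i).
Proof.
by move=> eL; apply: (big_morph e (fun u v => linear_add u v eL) (linear_zero eL)).
Qed.

Lemma linear_hom (F : fieldType) (M N : vectType F) (e : M -> N) :
  linear e -> exists phi : 'Hom(M, N), forall x, phi x = e x.
Proof.
move=> eL; pose el := HB.pack_for {linear M -> N} e (GRing.isLinear.Build F M N *:%R e eL).
by exists (linfun el) => x; rewrite lfunE.
Qed.

Lemma iter_zero (F : fieldType) (M : lmodType F) (e : M -> M) k n x :
  linear e -> (k <= n)%N -> iter k e x = 0 -> iter n e x = 0.
Proof.
move=> eL /subnK <-; rewrite iterD => ->.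
exact/linear_zero/iter_linear.
Qed.

(* The operators e, f raise and lower the eigenvalue of h by kap, and [e, f] = h; kap = 2 is
   sl_2, and kap = 0 is the Heisenberg algebra. The predicate wt b stands for h = b. *)
Section RaisingLowering.
Context {F : fieldType} {M : lmodType F} (e f : M -> M) (kap : F) (wt : F -> M -> Prop).
Hypotheses (eL : linear e) (fL : linear f).
Hypothesis wt_e : forall b v, wt b v -> wt (b + kap) (e v).
Hypothesis ef_comm : forall b v, wt b v -> e (f v) - f (e v) = b *: v.

(** The commutator of e^(k+1) with f is the sum of e^(k-j) h e^j over j <= k, and h takes the value
    b + j kap on e^j v; the coefficient below is the sum of these values. *)
Lemma iter_raise_lower k b v : wt b v ->
  iter k.+1 e (f v) =
  f (iter k.+1 e v) + (k.+1%:R * b + kap * 'C(k.+1, 2)%:R) *: iter k e v.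
Proof.
elim: k b v => [|k IHk] b v bv.
  by rewrite /= bin_small // mulr0 addr0 mul1r -(ef_comm bv) addrC subrK.
have -> : iter k.+2 e (f v) = iter k.+1 e (f (e v)) + b *: iter k.+1 e v.
  rewrite iterSr -[e (f v)](subrK (f (e v))) (ef_comm bv) addrC.
  rewrite linear_add; last exact: iter_linear.
  by rewrite [X in _ + X]linear_scale //; exact: iter_linear.
rewrite (IHk _ _ (wt_e bv)) -!iterSr -addrA -scalerDl; congr (_ + _ *: _).
rewrite (binS k.+1 1) bin1 natrD [k.+2%:R]mulrSr; ring.
Qed.

End RaisingLowering.

(** * Locally nilpotent raising and lowering operators *)

Section Sl2.
Context {F : numFieldType} {M : lmodType F} (e f : M -> M).
Hypotheses (eL : linear e) (fL : linear f).

Lemma exists_extremal (g : M -> M) v : locally_nilpotent g -> v != 0 ->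
  exists2 k, iter k g v != 0 & iter k.+1 g v = 0.
Proof.
move=> gN v0; have exN : exists n, iter n g v == 0 by have [n nP] := gN v; exists n; apply/eqP.
case: (ex_minnP exN) => -[|k] /eqP k0 kmin; first by rewrite /= in k0; rewrite k0 eqxx in v0.
by exists k => //; apply/negP => /kmin; rewrite ltnn.
Qed.

Lemma half_bin k : 2%:R * 'C(k.+1, 2)%:R = k.+1%:R * k%:R :> F.
Proof. by rewrite -!natrM mulnC -[2%N]/(2`!) bin_ffact ffactnS ffactn1. Qed.

(** Take the last nonzero e^k v, and then the last nonzero f^n applied to it: the commutation
    formula for f^(n+1) gives 2a = kap (n - 2k). The case kap = 0, where a = 0 results, is what
    later excludes al([x, y]) = 0. *)
Lemma integral_weight (kap : F) (wt : F -> M -> Prop) a v :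
    (forall b v, wt b v -> wt (b + kap) (e v)) ->
    (forall b v, wt b v -> wt (b - kap) (f v)) ->
    (forall b v, wt b v -> e (f v) - f (e v) = b *: v) ->
    locally_nilpotent e -> locally_nilpotent f -> wt a v -> v != 0 ->
  exists z : int, 2%:R * a = kap * z%:~R.
Proof.
move=> wt_e wt_f ef eN fN av v0.
have [k k0 kS] := exists_extremal eN v0.
have wk : wt (a + kap * k%:R) (iter k e v).
  elim: (k) => [|j IHj]; first by rewrite mulr0 addr0.
  by rewrite /= mulrSr mulrDr mulr1 addrA; apply: wt_e.
have [n n0 nS] := exists_extremal fN k0.
(* The formula is used with e and f exchanged, which reverses the sign of h. *)
have wf b w : wt (- b) w -> wt (- (b + kap)) (f w) by rewrite opprD; apply: wt_f.
have fe b w : wt (- b) w -> f (e w) - e (f w) = b *: w.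
  by move=> bw; rewrite -opprB (ef _ _ bw) scaleNr opprK.
rewrite -[a + _]opprK in wk.
have := iter_raise_lower (wt := fun b w => wt (- b) w) fL wf fe n wk.
rewrite -iterS kS nS !linear_zero //; last exact: (iter_linear fL n.+1).
rewrite add0r => /esym/eqP; rewrite scaler_eq0 (negPf n0) orbF.
rewrite mulrN addrC subr_eq0 => /eqP /(congr1 (fun x => 2%:R * x)).
rewrite mulrCA half_bin mulrCA [in RHS]mulrCA => /mulfI.
rewrite pnatr_eq0 => /(_ isT) E; exists (n%:Z - (2 * k)%:Z).
by rewrite intrB -!pmulrn mulrBr E natrM; ring.
Qed.

(* If e^k v = 0, then e^(k-1) kills e (f v) - c v for a nonzero constant c, so that v is in
   the image of e by induction on k. *)
Lemma raise_surjective (wt : F -> M -> Prop) (A B : set M) b :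
    (forall b v, wt b v -> wt (b + 2%:R) (e v)) ->
    (forall b v, wt b v -> e (f v) - f (e v) = b *: v) ->
    (forall v, A v -> wt b v) -> (forall v, A v -> B (f v)) -> (forall v, B v -> A (e v)) ->
    (forall a u v, A u -> A v -> A (a *: u + v)) ->
    (forall a u v, B u -> B v -> B (a *: u + v)) ->
    locally_nilpotent e -> (0 < b) ->
  forall v, A v -> exists2 u, B u & v = e u.
Proof.
move=> wt_e ef wtA AB BA AL BL eN b0 v Av; have [k vk] := eN v.
elim: k v Av vk => [|k IHk] v Av vk.
  exists (f v); first exact: AB.
  by rewrite /= in vk; rewrite vk !linear_zero.
set c := k.+1%:R * b + 2%:R * 'C(k.+1, 2)%:R.
have c0 : c != 0.
  by rewrite gt_eqF // ltr_pwDl ?mulr_gt0 ?mulr_ge0 ?ler0n ?ltr0n.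
have [|| u Bu vu] := IHk (- c *: v + e (f v)).
- by apply: AL => //; apply/BA/AB.
- have := iter_raise_lower (kap := 2%:R) eL wt_e ef k (wtA _ Av).
  rewrite vk linear_zero // add0r -/c iterSr (iter_linear eL k) => ->.
  by rewrite scaleNr addrC subrr.
exists (c^-1 *: (f v - u)).
  have := BL (- c^-1) _ _ Bu (BL (c^-1) _ _ (AB _ Av) (BL (-1) _ _ Bu Bu)).
  by rewrite scaleN1r addNr addr0 scaleNr addrC -scalerBr.
rewrite linear_scale // linear_sub // -vu scaleNr opprD opprK addrC subrK.
by rewrite scalerA mulVf ?scale1r.
Qed.

End Sl2.

Lemma lspan_sub (F : fieldType) (M : lmodType F) (S T : set M) x :
  (forall y, S y -> T y) -> lspan S x -> lspan T x.
Proof. by move=> ST [s sS ->]; exists s => // p /sS/ST. Qed.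

(** * Independence of joint eigenvectors *)

Section JointEigenvectors.
Context {F : fieldType} {M : lmodType F} {H : Type} (T : H -> M -> M).
Hypothesis TL : forall h, linear (T h).

(** If h separates nu i from mu, then T h - nu i h kills x i, rescales the other terms and
    multiplies u by a nonzero scalar; this removes one term of the sum. *)
Lemma joint_eigen_indep (I : eqType) (nu : I -> H -> F) (s : seq I) (x : I -> M)
    (mu : H -> F) u :
  (forall i, i \in s -> exists h, nu i h != mu h) ->
  (forall i, i \in s -> forall h, T h (x i) = nu i h *: x i) ->
  (forall h, T h u = mu h *: u) ->
  u = \sum_(i <- s) x i -> u = 0.
Proof.
elim: s x u => [|i s IHs] x u hs hx hu; first by rewrite big_nil.
rewrite big_cons => uE; have [h /negP hneq] := hs i (mem_head _ _).
have in_s j : j \in s -> j \in i :: s by rewrite inE orbC => ->.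
have k0 : (mu h - nu i h) *: u = 0.
  apply: (IHs (fun j => (nu j h - nu i h) *: x j)).
  - by move=> j /in_s; apply: hs.
  - by move=> j /in_s js h'; rewrite linear_scale // hx // !scalerA mulrC.
  - by move=> h'; rewrite linear_scale // hu !scalerA mulrC.
  rewrite scalerBl -hu uE linear_add // linear_sumE // hx ?mem_head //.
  rewrite scalerDr opprD addrACA subrr add0r scaler_sumr -sumrB.
  by apply: eq_big_seq => j /in_s js; rewrite hx // scalerBl.
move/eqP: k0; rewrite scaler_eq0 subr_eq0 eq_sym => /orP[/eqP E|/eqP //].
by case: hneq; apply/eqP.
Qed.

End JointEigenvectors.

(** * The root system *)

Section RootSystem.
Context {F : numFieldType} (g : vectType F) (br : g -> g -> g).
Hypothesis g_simple : is_simple br.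
Context (hd : {vspace g}).
Hypothesis hd_cartan : is_cartan br hd.

Let br_bilin : bilin br. Proof. by case: g_simple => -[]. Qed.

Lemma br_linl y : linear (br^~ y). Proof. exact: br_bilin.1. Qed.
Lemma br_linr x : linear (br x). Proof. exact: br_bilin.2. Qed.

Lemma br_anti x y : br x y = - br y x.
Proof.
have [[_ xx _] _] := g_simple; have := xx (x + y).
rewrite (linear_add _ _ (br_linl _)) !(linear_add _ _ (br_linr _)) !xx add0r addr0.
by move/eqP; rewrite addr_eq0 => /eqP.
Qed.

Lemma br_jacobi x y z : br x (br y z) = br (br x y) z + br y (br x z).
Proof.
have [[_ _ J] _] := g_simple; have /eqP := J x y z.
rewrite -addrA addr_eq0 => /eqP ->; rewrite opprD addrC.
rewrite [br z _]br_anti opprK; congr (_ + _).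
by rewrite [br x z]br_anti (linear_opp _ (br_linr y)).
Qed.

Lemma cartan_comm h h' x : h \in hd -> h' \in hd -> br h (br h' x) = br h' (br h x).
Proof.
by move=> hh hh'; case: hd_cartan => /(_ h h' hh hh') E _ _; rewrite br_jacobi E
   (linear_zero (br_linl x)) add0r.
Qed.

(** Induction on the list: a joint eigenvector for the tail is split into its ad h-eigencomponents
    [y b], and these remain eigenvectors for the tail because the operators commute. *)
Lemma joint_diagonalization (hs : seq g) : {subset hs <= hd} ->
  forall x, lspan [set x | forall h, h \in hs -> exists a, br h x = a *: x] x.
Proof.
elim: hs => [|h hs IHs] sub x; first by apply: lspan_gen.
have hh : h \in hd by apply: sub; rewrite mem_head.
have sub' : {subset hs <= hd} by move=> h' h's; apply: sub; rewrite inE h's orbT.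
apply: (lspan_min (P := lspan _)) (IHs sub' x) => [|a u v Pu Pv|{}x xP]; first exact: lspan0.
  by apply: lspanD => //; apply: lspanZ.
have [_ _ /(_ h hh) [e /andP[/eqP span_e free_e] eP]] := hd_cartan.
have /choice[a aP] (i : 'I_(size e)) : exists b, br h (nth 0 e i) = b *: nth 0 e i.
  exact/eP/mem_nth.
pose bs := undup [seq a i | i <- enum 'I_(size e)].
pose y b := \sum_(i < size e | a i == b) coord (in_tuple e) i x *: nth 0 e i.
have xE : x = \sum_(b <- bs) y b.
  have x_e : x \in <<in_tuple e>>%VS by rewrite span_e memvf.
  transitivity (\sum_(i < size e) coord (in_tuple e) i x *: nth 0 e i); first exact: coord_span.
  rewrite (exchange_big_dep xpredT) //=; apply: eq_bigr => i _.
  have ai : a i \in bs by rewrite mem_undup map_f ?mem_enum.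
  rewrite big_mkcond (bigD1_seq (a i)) ?undup_uniq //= eqxx big1 ?addr0 // => b bai.
  by rewrite eq_sym (negPf bai).
have yh b : br h (y b) = b *: y b.
  rewrite linear_sumE; last exact: br_linr.
  rewrite scaler_sumr; apply: eq_bigr => i /eqP <-.
  by rewrite (linear_scale _ _ (br_linr h)) aP !scalerA mulrC.
rewrite xE; elim/big_ind: _ => [|u v|b _]; [exact: lspan0|exact: lspanD|].
apply: lspan_gen => h'; rewrite inE => /orP[/eqP ->|h's]; first by exists b; apply: yh.
have [c xc] := xP h' h's; exists c; apply/eqP; rewrite -subr_eq0; apply/eqP.
rewrite -opprB; apply/eqP; rewrite oppr_eq0; apply/eqP.
have [bbs|bbs] := boolP (b \in bs); last first.
  have -> : y b = 0; last by rewrite (linear_zero (br_linr h')) scaler0 subr0.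
  apply: big_pred0 => i; apply/negP => /eqP ib; move: bbs.
  by rewrite -ib mem_undup map_f // mem_enum.
(* The defects [c *: y b - br h' (y b)] are eigenvectors of ad h for distinct eigenvalues b and sum
   to zero, so each of them vanishes. *)
apply: (@joint_eigen_indep F g unit (fun=> br h) _ F (fun b _ => b)
  [seq b' <- bs | b' != b] (fun b' => if b' == b then 0 else br h' (y b') - c *: y b')
  (fun=> b)).
- by move=> _; apply: br_linr.
- by move=> b'; rewrite mem_filter => /andP[b'b _]; exists tt.
- move=> b' _ _; case: eqP => _; first by rewrite (linear_zero (br_linr h)) scaler0.
  rewrite (linear_sub _ _ (br_linr h)) (linear_scale _ _ (br_linr h)).
  rewrite (cartan_comm _ hh (sub' _ h's)) yh (linear_scale _ _ (br_linr h')).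
  by rewrite scalerBr !scalerA mulrC.
- move=> _; rewrite (linear_sub _ _ (br_linr h)) (linear_scale _ _ (br_linr h)).
  rewrite (cartan_comm _ hh (sub' _ h's)) yh (linear_scale _ _ (br_linr h')).
  by rewrite scalerBr !scalerA mulrC.
- have : \sum_(b' <- bs) (c *: y b' - br h' (y b')) = 0.
    by rewrite sumrB -scaler_sumr -(linear_sumE _ _ _ (br_linr h')) -xE xc subrr.
  rewrite (bigD1_seq b) ?undup_uniq //= => /eqP; rewrite addr_eq0 => /eqP ->.
  by rewrite big_filter -sumrN; apply: eq_bigr => b' /negPf ->; rewrite opprB.
Qed.

(** The eigenvalue is read off as the coordinate of [h, x] along x, which makes its linearity in h
    evident. *)
Lemma root_space_witness x : x != 0 -> (forall h, h \in hd -> exists a, br h x = a *: x) ->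
  exists al : hdual hd, root_space br al x.
Proof.
move=> x0 xP; pose phi (h : subvs_of hd) : F^o := coord [tuple x] ord0 (br (vsval h) x).
have phiL : linear phi.
  by move=> a h h'; rewrite /phi linearP br_linl linearP.
have [al alE] := linear_hom phiL; exists al => h; rewrite alE /phi.
have [a ->] := xP _ (subvsP h); rewrite linearZ /=.
have xfree : free [tuple x] by rewrite seq1_free.
by rewrite (coord_free ord0 ord0 xfree) mulr1.
Qed.


Lemma root_spaceL al a x y :
  root_space br al x -> root_space br al y -> root_space (hd := hd) br al (a *: x + y).
Proof. by move=> xP yP h; rewrite br_linr xP yP scalerDr !scalerA mulrC. Qed.

Lemma root_space_zero al : root_space (hd := hd) br al 0.
Proof. by move=> h; rewrite (linear_zero (br_linr _)) scaler0. Qed.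

Lemma root_decomposition x : lspan [set x | exists al : hdual hd, root_space br al x] x.
Proof.
have vb_sub : {subset vbasis hd <= hd} by move=> h; apply: vbasis_mem.
apply: lspan_sub (joint_diagonalization vb_sub x) => {}x xP.
have [->|x0] := eqVneq x 0; first by exists 0; apply: root_space_zero.
apply: root_space_witness => // h hh; rewrite (coord_vbasis hh).
have /choice[a aP] (i : 'I_(\dim hd)) : exists b, br (vbasis hd)`_i x = b *: x.
  by apply: xP; apply: mem_nth; rewrite size_tuple.
exists (\sum_i coord (vbasis hd) i h * a i); rewrite scaler_suml.
rewrite (linear_sumE _ _ _ (br_linl x)); apply: eq_bigr => i _.
by rewrite (linear_scale _ _ (br_linl x)) aP scalerA.
Qed.

(** Obtained by decomposing each vector of a basis of [g]. Each vector carries its root as a label;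
    labels may repeat and may be 0. *)
Lemma homogeneous_basis : exists E : seq (hdual hd * g),
  [/\ uniq E, forall p, p \in E -> root_space br p.1 p.2
    & forall x, exists c : hdual hd * g -> F, x = \sum_(p <- E) c p *: p.2].
Proof.
pose vecs (E : seq (hdual hd * g)) : set g := [set y | exists2 p, p \in E & y = p.2].
have vecs_cat E1 E2 x : lspan (vecs E1) x \/ lspan (vecs E2) x -> lspan (vecs (E1 ++ E2)) x.
  by case; apply: lspan_sub => _ [p pE ->]; exists p; rewrite // mem_cat pE ?orbT.
have one x : exists2 E, forall p, p \in E -> root_space br p.1 p.2 & lspan (vecs E) x.
  apply: (lspan_min (P := [set x | exists2 E, forall p, p \in E -> root_space br p.1 p.2
    & lspan (vecs E) x])) (root_decomposition x) => [|a u v [E1 h1 u1] [E2 h2 v2]|y [al yal]].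
  - by exists [::] => //; apply: lspan0.
  - exists (E1 ++ E2) => [p|]; first by rewrite mem_cat => /orP[/h1|/h2].
    by apply: lspanD; [apply: lspanZ|]; apply: vecs_cat; [left|right].
  - exists [:: (al, y)] => [p|]; first by rewrite inE => /eqP ->.
    by apply: lspan_gen; exists (al, y); rewrite ?mem_head.
have many (X : seq g) : exists2 E, forall p, p \in E -> root_space br p.1 p.2
    & forall x, x \in X -> lspan (vecs E) x.
  elim: X => [|y s [E EP Es]]; first by exists [::].
  have [E' EP' Ey] := one y; exists (E' ++ E) => [p|x].
    by rewrite mem_cat => /orP[/EP'|/EP].
  by rewrite inE => /orP[/eqP ->|/Es xE]; apply: vecs_cat; [left|right].
have [E EP Espan] := many (vbasis {:g}).
exists (undup E); split=> [|p|x]; [exact: undup_uniq|by rewrite mem_undup => /EP|].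
have xE : lspan (vecs E) x.
  rewrite (coord_vbasis (memvf x)); elim/big_ind: _ => [|u v|i _]; [exact: lspan0|exact: lspanD|].
  by apply: lspanZ; apply: Espan; apply: mem_nth; rewrite size_tuple.
apply: (lspan_min (P := [set x | exists c : hdual hd * g -> F,
  x = \sum_(p <- undup E) c p *: p.2])) xE => [|a u v [c ->] [d ->]|_ [p pE ->]].
- by exists (fun=> 0); rewrite big1 // => p _; rewrite scale0r.
- exists (fun p => a * c p + d p); rewrite scaler_sumr -big_split /=.
  by apply: eq_bigr => p _; rewrite scalerDl scalerA.
- exists (fun q => (q == p)%:R); rewrite (bigD1_seq p) ?undup_uniq ?mem_undup //=.
  by rewrite eqxx scale1r big1 ?addr0 // => q /negPf ->; rewrite scale0r.
Qed.

Lemma hdual_neq (al be : hdual hd) : al != be -> exists h, al h != be h.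
Proof.
move=> /eqP ab; apply: contrapT => nex; apply: ab; apply/lfunP => h.
by apply: contrapT => /eqP neq; apply: nex; exists h.
Qed.

Lemma root_space_br al be x y : root_space br al x -> root_space br be y ->
  root_space (hd := hd) br (al + be) (br x y).
Proof.
move=> xP yP h; rewrite br_jacobi xP yP (linear_scale _ _ (br_linl y)).
by rewrite (linear_scale _ _ (br_linr x)) -scalerDl lfunE.
Qed.

Lemma root_space0_cartan x : root_space br (0 : hdual hd) x -> x \in hd.
Proof.
move=> xP; case: hd_cartan => _ + _; apply => h hh.
by rewrite -(vsprojK hh) xP lfunE scale0r.
Qed.

Lemma cartan_root_space0 h : h \in hd -> root_space br (0 : hdual hd) h.
Proof.
by move=> hh h'; case: hd_cartan => -> //; rewrite ?subvsP // lfunE scale0r.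
Qed.

(** * Finiteness and integrality of the roots *)

Section HomogeneousBasis.
Variable E : seq (hdual hd * g).
Hypothesis E_hom : forall p, p \in E -> root_space br p.1 p.2.
Hypothesis E_span : forall x, exists c : hdual hd * g -> F, x = \sum_(p <- E) c p *: p.2.

(** A root vector with a missing label would be a sum of eigenvectors for other weights, hence zero.
    In particular the set of roots is finite. *)
Lemma weight_in_basis (al : hdual hd) x : root_space br al x -> x != 0 -> al \in map fst E.
Proof.
move=> xP; apply: contraNT => alE; apply/eqP; have [c xE] := E_span x.
apply: (@joint_eigen_indep F g (subvs_of hd) (fun h => br (vsval h)) (fun h => br_linr _)
  (hdual hd * g)%type
  (fun p h => p.1 h) E (fun p => c p *: p.2) (fun h => al h) x _ _ xP xE).
- by move=> p pE; apply: hdual_neq; apply: contraNneq alE => <-; apply: map_f.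
- by move=> p pE h; rewrite (linear_scale _ _ (br_linr _)) E_hom // !scalerA mulrC.
Qed.

Lemma root_vector_iter (al be : hdual hd) x y k : root_space br al x -> root_space br be y ->
  root_space (hd := hd) br (be + al *+ k) (iter k (br x) y).
Proof.
move=> xP yP; elim: k => [|k IHk]; first by rewrite addr0.
by rewrite mulrS addrCA; apply: root_space_br.
Qed.

(** Pigeonhole: if the iterate of order [size E] were nonzero on a root vector, then [size E] + 1
    distinct labels be + k al would occur in [E]. *)
Lemma root_vector_nilpotent (al : hdual hd) x :
  root_space br al x -> al != 0 -> locally_nilpotent (br x).
Proof.
move=> xP al0 y; exists (size E); have [c ->] := E_span y.
rewrite (linear_sumE _ _ _ (iter_linear (br_linr x) _)) big_seq big1 // => -[be v] pE.
rewrite (linear_scale _ _ (iter_linear (br_linr x) _)).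
suff -> : iter (size E) (br x) v = 0 by rewrite scaler0.
apply: contrapT => /eqP nz.
pose ws := [seq be + al *+ k | k <- iota 0 (size E).+1].
have: (size ws <= size (map fst E))%N.
  apply: uniq_leq_size => [|_ /mapP[k k_in ->]].
    rewrite map_inj_uniq ?iota_uniq // => j k /addrI/eqP.
    have [h alh] := hdual_neq al0; rewrite lfunE /= in alh.
    move/eqP => /(congr1 (fun f : hdual hd => f h)).
    rewrite -!scaler_nat !lfunE /= => /(mulIf alh)/eqP.
    by rewrite eqr_nat => /eqP.
  apply: weight_in_basis (root_vector_iter k xP (E_hom pE)) _.
  apply: contraNneq nz => kz; apply/eqP; apply: iter_zero kz; first exact: br_linr.
  by move: k_in; rewrite mem_iota add0n ltnS.
by rewrite !size_map size_iota ltnn.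
Qed.

(** Such an h acts by zero on a spanning set, so it is central and its line is an ideal; that line
    is not all of [g], where some bracket is nonzero. *)
Lemma cartan_faithful (h : subvs_of hd) :
  (forall al : hdual hd, is_root br al -> al h = 0) -> h = 0.
Proof.
move=> h0; have hc x : br (vsval h) x = 0.
  have [c ->] := E_span x; rewrite (linear_sumE _ _ _ (br_linr _)) big_seq big1 // => p pE.
  rewrite (linear_scale _ _ (br_linr _)) E_hom //.
  have [->|p0] := eqVneq p.2 0; first by rewrite !scaler0.
  have [->|al0] := eqVneq p.1 0; first by rewrite lfunE /= scale0r scaler0.
  rewrite h0 ?scale0r ?scaler0 //; split=> //; exists p.2 => //; exact: E_hom.
have [_ [[x [y xy]] /(_ <[vsval h]>%VS)]] := g_simple; case.
- move=> u v /vlineP[a ->]; rewrite (linear_scale _ _ (br_linr u)) br_anti hc.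
  by rewrite oppr0 scaler0 mem0v.
- move/eqP; rewrite -subv0 -memvE memv0 => /eqP E0.
  by rewrite -[h]vsvalK E0 linear0.
- move=> full; have /vlineP[a xE] : x \in <[vsval h]>%VS by rewrite full memvf.
  by rewrite xE (linear_scale _ _ (br_linl y)) hc scaler0 eqxx in xy.
Qed.

(** The string argument for the adjoint action of x, y and t = [x, y], with kap = al(t), which may
    still be zero at this point. *)
Lemma root_string_integral (al be : hdual hd) x y (t : subvs_of hd) :
  is_root br al -> is_root br be -> root_space br al x -> root_space br (- al) y ->
  br x y = vsval t -> exists z : int, 2%:R * be t = al t * z%:~R.
Proof.
move=> [al0 _] [_ [v vP v0]] xP yP xy.
apply: (@integral_weight _ _ (br x) (br y) _ _ (al t)
  (fun b v => exists2 ga : hdual hd, root_space br ga v & ga t = b) _ v) => //.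
- exact: br_linr.
- exact: br_linr.
- move=> b w [ga wP <-]; exists (al + ga); first exact: root_space_br.
  by rewrite lfunE addrC.
- move=> b w [ga wP <-]; exists (- al + ga); first exact: root_space_br.
  by rewrite add_lfunE opp_lfunE addrC.
- by move=> b w [ga wP <-]; rewrite br_jacobi addrK xy wP.
- exact: root_vector_nilpotent xP al0.
- by apply: root_vector_nilpotent yP _; rewrite oppr_eq0.
- by exists be.
Qed.

(** * The invariant form and sl_2-triples *)

Section InvariantForm.
Variable form : g -> g -> F^o.
Hypothesis form_inv : is_invariant_form br form.
Hypothesis form_pos : is_positive_form br hd form.

Let form_bilin : bilin form. Proof. by case: form_inv. Qed.
Let formL y : linear (form^~ y). Proof. exact: form_bilin.1. Qed.
Let formR x : linear (form x). Proof. exact: form_bilin.2. Qed.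
Let formC x y : form x y = form y x. Proof. by case: form_inv. Qed.
Let form_br x y z : form (br x y) z = form x (br y z). Proof. by case: form_inv. Qed.

Let formvL y : linear (fun h : subvs_of hd => form (vsval h) y).
Proof. by move=> a h h'; rewrite linearP formL. Qed.

Lemma form_orthogonal (al be : hdual hd) x y : root_space br al x -> root_space br be y ->
  be != - al -> form x y = 0.
Proof.
move=> xP yP /hdual_neq[h]; rewrite lfunE /= => hneq.
have inv : al h * form x y = - be h * form x y.
  transitivity (form (br (vsval h) x) y); first by rewrite xP (linear_scale _ _ (formL y)).
  rewrite br_anti (linear_opp _ (formL y)) form_br yP (linear_scale _ _ (formR x)).
  by rewrite mulNr.
apply/eqP; move/eqP: inv; rewrite -subr_eq0 -mulrBl mulf_eq0 => /orP[|//].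
by rewrite opprK addrC addr_eq0 (negPf hneq).
Qed.

Lemma form_pairing (al : hdual hd) x : root_space br al x -> x != 0 ->
  exists2 y, root_space br (- al) y & form x y != 0.
Proof.
move=> xP x0; apply: contrapT => nex; case/eqP: x0.
case: form_inv => _ _ _; apply=> y; have [c ->] := E_span y.
rewrite (linear_sumE _ _ _ (formR x)) big_seq big1 // => -[be v] pE.
rewrite (linear_scale _ _ (formR x)) /=.
have vP : root_space br be v := E_hom pE.
have [bal|bal] := eqVneq be (- al); last by rewrite (form_orthogonal xP vP bal) scaler0.
apply: contrapT => /eqP nz; apply: nex; exists v; first by rewrite -bal.
by apply: contra_neq nz => ->; rewrite scaler0.
Qed.

(** The number [form x y] is 2/(al|al) for the induced form on the dual; it scales the central
    charge in the coroot of a loop sl_2. *)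
Definition sl2_triple (al : hdual hd) (x y : g) (h : subvs_of hd) : Prop :=
  [/\ root_space br al x, root_space br (- al) y, br x y = vsval h, al h = 2%:R
    & [/\ 0 < form x y, forall h' : subvs_of hd, form (vsval h) (vsval h') = form x y * al h'
        & forall be : hdual hd, is_root br be -> exists z : int, be h = z%:~R]].

Lemma sl2_triple_exists (al : hdual hd) : is_root br al -> exists x y h, sl2_triple al x y h.
Proof.
move=> al_root; have [al0 [x xP x0]] := al_root.
have [y yP xy0] := form_pairing xP x0.
have brh : br x y \in hd by apply: root_space0_cartan; rewrite -(subrr al); apply: root_space_br.
pose t : subvs_of hd := vsproj hd (br x y).
have tE : br x y = vsval t by rewrite /t vsprojK.
have form_t y' (h : subvs_of hd) : root_space br (- al) y' ->
    form (br x y') (vsval h) = form x y' * al h.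
  move=> y'P; rewrite form_br br_anti (linear_opp _ (formR x)) y'P.
  by rewrite (linear_scale _ _ (formR x)) lfunE /= scaleNr opprK mulrC.
(* If al(t) = 0, integrality of strings makes every root vanish at t, so t = 0; this contradicts
   (t|h) = (x|y) al(h) with (x|y) and some al(h) nonzero. *)
have al_t : al t != 0.
  apply/eqP => t0; suff t_0 : t = 0.
    have [h /negP[]] := hdual_neq al0; rewrite lfunE /=.
    have := form_t y h yP; rewrite tE t_0 linear0 (linear_zero (formL _)) => /esym/eqP.
    by rewrite mulf_eq0 (negPf xy0).
  apply: cartan_faithful => be be_root.
  have [z] := root_string_integral al_root be_root xP yP tE.
  by rewrite t0 mul0r => /eqP; rewrite mulf_eq0 pnatr_eq0 => /eqP.
pose s := 2%:R / al t; have syP : root_space br (- al) (s *: y).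
  by have := root_spaceL s yP (root_space_zero (- al)); rewrite addr0.
have hE : br x (s *: y) = vsval (s *: t) by rewrite (linear_scale _ _ (br_linr x)) tE linearZ.
have al_h : al (s *: t) = 2%:R by rewrite linearZ; apply: (divfK al_t).
have int_h be : is_root br be -> exists z : int, be (s *: t) = z%:~R.
  move=> be_root; have [z] := root_string_integral al_root be_root xP syP hE.
  by rewrite al_h => /mulfI; rewrite pnatr_eq0 => /(_ isT) ->; exists z.
have form_h h' : form (vsval (s *: t)) (vsval h') = form x (s *: y) * al h'.
  by rewrite -hE form_t.
exists x, (s *: y), (s *: t); split=> //; split=> //.
(* Roots take integer, hence real, values on the coroot, so the positivity of the form applies; then
   (h|h) = 2 (x|y). *)
have : 0 < form (vsval (s *: t)) (vsval (s *: t)).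
  apply: form_pos => [|be be_root]; last by have [z ->] := int_h be be_root; apply: rpred_int.
  by apply/eqP => h0; move: al_h; rewrite h0 linear0 => /esym/eqP; rewrite pnatr_eq0.
by rewrite form_h al_h pmulr_lgt0 ?ltr0n.
Qed.

Lemma sl2_triple_opp al x y h : sl2_triple al x y h -> sl2_triple (- al) y x (- h).
Proof.
case=> xP yP xy alh [xy0 hP hint]; split=> //; rewrite ?opprK //.
- by rewrite br_anti xy linearN.
- by rewrite opp_lfunE linearN opprK.
split=> [|h'|be /hint[z bez]]; first by rewrite formC.
- by rewrite linearN /= (linear_opp _ (formL _)) hP opp_lfunE formC mulrN.
- by exists (- z); rewrite linearN /= bez mulrNz.
Qed.

Lemma form_nondegenerate_cartan (h : subvs_of hd) :
  (forall h' : subvs_of hd, form (vsval h) (vsval h') = 0) -> h = 0.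
Proof.
move=> h0; apply: contrapT => /eqP hn0.
have hv0 : vsval h != 0.
  by apply: contraNneq hn0 => E0; rewrite -[h]vsvalK E0 linear0.
have [y] := form_pairing (cartan_root_space0 (subvsP h)) hv0.
by rewrite oppr0 => /root_space0_cartan yh; rewrite -(vsprojK yh) h0 eqxx.
Qed.

Lemma form_representer (mu : hdual hd) :
  exists t : subvs_of hd, forall h, form (vsval t) (vsval h) = mu h.
Proof.
have /choice[phi phiE] (t : subvs_of hd) :
    exists al : hdual hd, forall h, al h = form (vsval t) (vsval h).
  apply: (@linear_hom F (subvs_of hd) F^o) => a u v.
  by rewrite linearP formR.
have [phil philE] : exists f : 'Hom(subvs_of hd, hdual hd), forall t, f t = phi t.
  apply: linear_hom => a u v; apply/lfunP => h.
  by rewrite add_lfunE scale_lfunE !phiE linearP formL.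
have ker0 : lker phil = 0%VS.
  apply/eqP; rewrite -subv0; apply/subvP => t; rewrite memv_ker memv0 philE => /eqP t0.
  by apply/eqP/form_nondegenerate_cartan => h; rewrite -phiE t0 zero_lfunE.
have full : limg phil = fullv.
  apply/eqP; rewrite eqEdim subvf limg_dim_eq ?ker0 ?capv0 // !dimvf.
  by rewrite {1}/dim /= muln1.
have /memv_imgP[t _ muE] : mu \in limg phil by rewrite full memvf.
by exists t => h; rewrite muE philE phiE.
Qed.

(** Both coroots, divided by their form values, represent al under the form; evaluating al, which is
    2 on each, fixes the scale. *)
Lemma sl2_triple_unique al x y h x' y' h' :
  sl2_triple al x y h -> sl2_triple al x' y' h' -> h = h' /\ form x y = form x' y'.
Proof.
case=> _ _ _ alh [xy0 hP _] [_ _ _ alh' [xy0' hP' _]].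
have E0 : form x' y' *: h = form x y *: h'.
  apply/eqP; rewrite -subr_eq0; apply/eqP/form_nondegenerate_cartan => h2.
  rewrite (linear_sub _ _ (formvL _)) !(linear_scale _ _ (formvL _)) hP hP'.
  by apply/eqP; rewrite subr_eq0; apply/eqP; apply: mulrCA.
have E1 : form x y = form x' y'.
  have := congr1 al E0; rewrite !linearZ /= alh alh' => /mulIf.
  by rewrite pnatr_eq0 => /(_ isT).
by split=> //; apply: (scalerI (lt0r_neq0 xy0)); rewrite {1}E1.
Qed.

(** * Integral and minuscule weights *)

Definition integral_weights (mu : hdual hd) : Prop :=
  forall al x y h, sl2_triple al x y h -> exists z : int, mu h = z%:~R.

(** Coroots come in opposite pairs, so an integral mu of this kind has values -1, 0, 1 only. No
    dominance is imposed, and 0 is included. *)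
Definition minuscule (mu : hdual hd) : Prop :=
  forall al x y h, sl2_triple al x y h -> mu h <= 1.

Lemma root_pairing_representer mu t al x y h : (forall h, form (vsval t) (vsval h) = mu h) ->
  sl2_triple al x y h -> al t = mu h / form x y.
Proof.
move=> tP [_ _ _ _ [xy0 hP _]]; apply: (mulfI (lt0r_neq0 xy0)).
by rewrite -hP formC tP mulrCA mulfV ?mulr1 ?lt0r_neq0.
Qed.

(** All roots vanish on the element of the Cartan subalgebra that represents mu - mu'. *)
Lemma coroots_separate (mu mu' : hdual hd) :
  (forall al, is_root br al -> exists x y h, sl2_triple al x y h /\ mu h = mu' h) -> mu = mu'.
Proof.
move=> muE; have [t tP] := form_representer (mu - mu').
apply/eqP; rewrite -subr_eq0; apply/eqP/lfunP => h; rewrite -tP zero_lfunE.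
rewrite (_ : t = 0) ?linear0 ?(linear_zero (formL _)) //.
apply: cartan_faithful => al al_root; have [x [y [h' [triple mh]]]] := muE al al_root.
by rewrite (root_pairing_representer tP triple) add_lfunE opp_lfunE mh subrr mul0r.
Qed.

Lemma finitely_many_words (T : eqType) (vals : seq T) n :
  exists ps : seq (seq T), forall t, size t = n -> {subset t <= vals} -> t \in ps.
Proof.
elim: n => [|n [ps psP]]; first by exists [:: [::]] => t /size0nil ->; rewrite mem_head.
exists [seq v :: t | v <- vals, t <- ps] => -[//|v t] [size_t] sub.
apply: allpairs_f; first by apply: sub; rewrite mem_head.
by apply: psP => // w wt; apply: sub; rewrite inE wt orbT.
Qed.

Lemma finitely_many_minuscule : exists s : seq (hdual hd),
  forall mu, integral_weights mu -> minuscule mu -> mu \in s.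
Proof.
have /choice[H HP] (al : hdual hd) : exists h, is_root br al -> exists x y, sl2_triple al x y h.
  have [/sl2_triple_exists[x [y [h tr]]]|no] := pselect (is_root br al); last by exists 0.
  by exists h => _; exists x, y.
pose L := [seq al <- map fst E | `[< is_root br al >]].
pose pattern (mu : hdual hd) : seq F := [seq mu (H al) | al <- L].
have [ps psP] := finitely_many_words [:: -1; 0; 1 : F] (size L).
(* One weight is chosen for each pattern of values on the coroots, with default 0 for a pattern that
   is not realised; the pattern determines the weight. *)
exists [seq xget 0 [set mu | pattern mu = p] | p <- ps] => mu muint mumin.
have mu_ps : pattern mu \in ps.
  apply: psP; first by rewrite size_map.
  move=> _ /mapP[al + ->]; rewrite mem_filter => /andP[/asboolP/HP[x [y tr]] _].
  have [z muz] := muint _ _ _ _ tr; have := mumin _ _ _ _ tr.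
  have := mumin _ _ _ _ (sl2_triple_opp tr); rewrite linearN /= muz.
  rewrite -mulrNz -[1 : F]/(1%:~R) !ler_int !inE -[0 : F]/(0%:~R) -mulrNz !eqr_int.
  by case: z {muz} => [[|[|z]]|[|z]].
suff -> : mu = xget 0 [set mu' | pattern mu' = pattern mu] by apply: map_f.
have patE : pattern (xget 0 [set mu' | pattern mu' = pattern mu]) = pattern mu.
  by apply: (@xgetPex _ 0 [set mu' | pattern mu' = pattern mu]); exists mu.
apply: coroots_separate => al al_root; have [x [y tr]] := HP al al_root.
exists x, y, (H al); split=> //; have /eq_in_map -> // := esym patE.
rewrite mem_filter asboolT //=; have [_ [v vP v0]] := al_root.
exact: weight_in_basis vP v0.
Qed.

(** The form value depends only on the root, and there are finitely many roots. *)
Lemma form_values_bounded :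
  exists2 K, 0 < K & forall al x y h, is_root br al -> sl2_triple al x y h -> form x y <= K.
Proof.
have [K K0 KP] : exists2 K, 0 < K & forall al, al \in map fst E -> forall x y h,
    is_root br al -> sl2_triple al x y h -> form x y <= K.
  elim: (map fst E) => [|al s [K K0 KP]]; first by exists 1.
  have [/sl2_triple_exists[x [y [h tr]]]|no] := pselect (is_root br al); last first.
    by exists K => // be; rewrite inE => /orP[/eqP ->|/KP//] x y h /no.
  have xy0 : 0 < form x y by case: tr => _ _ _ _ [].
  exists (K + form x y) => [|be]; first exact: addr_gt0.
  rewrite inE => /orP[/eqP ->|bes] x' y' h' be_root tr'.
    by have [_ <-] := sl2_triple_unique tr tr'; rewrite ler_wpDl // ltW.
  by rewrite ler_wpDr ?(ltW xy0) //; apply: KP tr'.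
exists K => // al x y h al_root; apply: KP => //.
by have [_ [v vP v0]] := al_root; apply: weight_in_basis vP v0.
Qed.

(* Lowering mu by a root al with mu (al^vee) >= 2 decreases the square length of mu by at
   least 2 / K. *)
Lemma minuscule_descent (arch : forall x : F, 0 <= x -> exists n : nat, x < n%:R)
    (P : hdual hd -> Prop) :
  (forall mu, integral_weights mu -> minuscule mu -> P mu) ->
  (forall mu al x y h, integral_weights mu -> is_root br al -> sl2_triple al x y h ->
     2%:R <= mu h -> P (mu - al) -> P mu) ->
  forall mu, integral_weights mu -> P mu.
Proof.
move=> Pmin Pstep; have /choice[t tP] := form_representer.
have [K K0 KP] := form_values_bounded.
(* Here [mu (t mu)] is the square length (mu|mu); integrality makes the roots real on [t mu]. *)
have norm_ge0 mu : integral_weights mu -> 0 <= mu (t mu).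
  move=> muint; rewrite -tP; have [->|t0] := eqVneq (t mu) 0.
    by rewrite linear0 (linear_zero (formL _)).
  apply/ltW/form_pos => // be /sl2_triple_exists[x [y [h tr]]].
  rewrite (root_pairing_representer (tP mu) tr); have [z ->] := muint _ _ _ _ tr.
  have xy0 : 0 < form x y by case: tr => _ _ _ _ [].
  by rewrite rpredM ?rpred_int // rpredV gtr0_real.
(* This is (mu - al|mu - al) = (mu|mu) - (al|al) (mu(h) - 1). *)
have norm_step mu al x y h : sl2_triple al x y h ->
    (mu - al) (t (mu - al)) = mu (t mu) - 2%:R / form x y * (mu h - 1).
  move=> tr; have [_ _ _ alh [xy0 hP _]] := tr.
  have mut : mu (t al) = mu h / form x y.
    by rewrite -tP formC tP (root_pairing_representer (tP mu) tr).
  have alt : al (t al) = 2%:R / form x y.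
    by rewrite (root_pairing_representer (tP al) tr) alh.
  have -> : (mu - al) (t (mu - al)) = mu (t (mu - al)) - al (t (mu - al)).
    by rewrite add_lfunE opp_lfunE.
  have swap (be ga : hdual hd) : be (t ga) = ga (t be) by rewrite -(tP be) formC tP.
  rewrite [mu _]swap [al _]swap !add_lfunE !opp_lfunE mut alt swap mut.
  by field; apply: lt0r_neq0.
(* The factor K/2 normalises the square length so that each lowering costs at least 1. *)
suff main n mu : integral_weights mu -> mu (t mu) * (K / 2%:R) < n%:R -> P mu.
  move=> mu muint; have [|n] := arch (mu (t mu) * (K / 2%:R)); last exact: main.
  by rewrite mulr_ge0 ?norm_ge0 // divr_ge0 ?ler0n ?(ltW K0).
elim: n mu => [|n IHn] mu muint mun.
  by have := lt_geF mun; rewrite mulr_ge0 ?norm_ge0 // divr_ge0 ?ler0n ?(ltW K0).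
have [mumin|nmin] := pselect (minuscule mu); first exact: Pmin.
have [al [x [y [h [tr al_root muh]]]]] :
    exists al x y h, [/\ sl2_triple al x y h, is_root br al & 2%:R <= mu h].
  apply: contrapT => nex; apply: nmin => al x y h tr; have [z muz] := muint _ _ _ _ tr.
  rewrite muz -[1 : F]/(1%:~R) ler_int leNgt; apply/negP => z1; apply: nex.
  exists al, x, y, h; split=> //; last by rewrite muz -[2%:R]/(2%:~R) ler_int.
  have [xP yP _ alh [xy0 _ _]] := tr; split.
    by apply/eqP => al0; move/eqP: alh; rewrite al0 zero_lfunE eq_sym pnatr_eq0.
  by exists x => //; apply: contraTneq xy0 => ->; rewrite (linear_zero (formL _)) ltxx.
have sub_int : integral_weights (mu - al).
  move=> be x' y' h' tr'; have [z muz] := muint _ _ _ _ tr'.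
  have [_ _ _ _ [_ _ /(_ al al_root)[z' alz]]] := tr'.
  by exists (z - z'); rewrite add_lfunE opp_lfunE muz alz intrB.
apply: (Pstep _ _ _ _ _ muint al_root tr muh); apply: IHn => //.
have xy0 : 0 < form x y by case: tr => _ _ _ _ [].
rewrite (norm_step _ _ _ _ _ tr) mulrBl ltrBlDr (lt_le_trans mun) // mulrSr lerD2l.
have -> : 2%:R / form x y * (mu h - 1) * (K / 2%:R) = (K / form x y) * (mu h - 1).
  by field; apply: lt0r_neq0.
have muh1 : 1 <= mu h - 1 by rewrite lerBrDr -natr1 in muh *.
rewrite mulr_ege1 // ler_pdivlMr // mul1r.
exact: KP al_root tr.
Qed.

Lemma sl2_triple_root al x y h : sl2_triple al x y h -> is_root br al.
Proof.
move=> [xP _ _ alh [xy0 _ _]]; split.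
  by apply/eqP => al0; move/eqP: alh; rewrite al0 zero_lfunE eq_sym pnatr_eq0.
by exists x => //; apply: contraTneq xy0 => ->; rewrite (linear_zero (formL _)) ltxx.
Qed.

(** Without roots the Cartan subalgebra is zero by faithfulness, while [g] is spanned by its 0-root
    space, which lies in it. *)
Lemma root_exists : exists al : hdual hd, is_root br al.
Proof.
apply: contrapT => nex.
have hd0 (h : subvs_of hd) : h = 0 by apply: cartan_faithful => al al_root; case: nex; exists al.
have [_ [[x [y xy]] _]] := g_simple; case/eqP: xy; have [c ->] := E_span x.
rewrite (linear_sumE _ _ _ (br_linl y)) big_seq big1 // => p pE.
suff -> : p.2 = 0 by rewrite scaler0 (linear_zero (br_linl y)).
apply: contrapT => /eqP p0; have pP := E_hom pE.
have [p10|p10] := eqVneq p.1 0; last by case: nex; exists p.1; split=> //; exists p.2.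
rewrite p10 in pP; move/eqP: p0; apply.
by rewrite -(vsprojK (root_space0_cartan pP)) (hd0 (vsproj hd _)) linear0.
Qed.

(** * Extremal weights of loop modules *)

(* W mu n plays the role of the weight space of h-weight mu shifted by the null root n,
   X x m that of the operator x (x) t^m, and ell m that of the central element
   \sum_p m_p k_p. *)
Section LoopModule.
Context {Z : zmodType} (ell : Z -> int) {V : lmodType F}.
Variables (X : g -> Z -> V -> V) (W : hdual hd -> Z -> set V).
Hypothesis arch : forall x : F, 0 <= x -> exists n : nat, x < n%:R.
Hypothesis ellD : forall m n, ell (m + n) = ell m + ell n.
Hypothesis X_linr : forall x m, linear (X x m).
Hypothesis X_linl : forall m v, linear (fun x => X x m v).
Hypothesis W_zero : forall mu n, W mu n 0.
Hypothesis W_lin : forall mu n a u v, W mu n u -> W mu n v -> W mu n (a *: u + v).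
Hypothesis W_fin : forall mu n, fin_dim (W mu n).
Hypothesis X_W : forall al x m mu n v,
  root_space br al x -> W mu n v -> W (mu + al) (n + m) (X x m v).
Hypothesis X_cartan : forall (h : subvs_of hd) mu n v, W mu n v -> X (vsval h) 0 v = mu h *: v.
Hypothesis X_br : forall x y m v, X x m (X y (- m) v) - X y (- m) (X x m v) =
  X (br x y) 0 v + (form x y * (ell m)%:~R) *: v.
Hypothesis X_nil : forall (al : hdual hd) x m,
  is_root br al -> root_space br al x -> locally_nilpotent (X x m).

Let ell0 : ell 0 = 0.
Proof. by apply: (addrI (ell 0)); rewrite -ellD !addr0. Qed.

Let ellN m : ell (- m) = - ell m.
Proof. by apply/eqP; rewrite -addr_eq0 -ellD addNr ell0. Qed.

Definition occurs mu n : Prop := exists2 v, W mu n v & v != 0.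

(** The operators [X x m] and [X y (- m)] form an sl_2 pair with coroot h + (x|y) ell(m). On the
    target weight space its value exceeds the one in the hypothesis by 2, so it is positive and
    [raise_surjective] applies. *)
Lemma raise_onto (al mu : hdual hd) x y h (n m : Z) : sl2_triple al x y h ->
  -1 <= mu h + form x y * (ell m)%:~R ->
  forall v, W (mu + al) (n + m) v -> exists2 u, W mu n u & v = X x m u.
Proof.
move=> tr ge1; have [xP yP xy alh _] := tr.
pose wt b v := exists2 p : hdual hd * Z, W p.1 p.2 v & p.1 h + form x y * (ell m)%:~R = b.
apply: (@raise_surjective F V (X x m) (X y (- m)) _ _ wt (W (mu + al) (n + m)) (W mu n)
  (mu h + form x y * (ell m)%:~R + 2%:R)).
- exact: X_linr.
- exact: X_linr.
- move=> b v [[mu' n'] /= vP <-]; exists (mu' + al, n' + m); first exact: X_W.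
  by rewrite /= add_lfunE alh addrAC.
- move=> b v [[mu' n'] /= vP <-].
  by rewrite X_br xy (X_cartan _ vP) -scalerDl.
- by move=> v vP; exists (mu + al, n + m); rewrite //= add_lfunE alh addrAC.
- by move=> v /(X_W (- m) yP); rewrite !addrK.
- by move=> v /(X_W m xP).
- exact: W_lin.
- exact: W_lin.
- exact: X_nil (sl2_triple_root tr) xP.
- by rewrite -[2%:R]/(1 + 1) addrA ltr_wpDl ?ltr01 // -lerBlDr sub0r.
Qed.

Lemma occurs_lower (al mu : hdual hd) x y h (n m : Z) : sl2_triple al x y h ->
  -1 <= mu h + form x y * (ell m)%:~R -> occurs (mu + al) (n + m) -> occurs mu n.
Proof.
move=> tr ge1 [v /(raise_onto tr ge1)[u uP ->] Xu0]; exists u => //.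
by apply: contraNneq Xu0 => ->; rewrite (linear_zero (X_linr _ _)).
Qed.

(** For m = 0 the central term vanishes and the triple acts as an ordinary locally nilpotent
    sl_2. *)
Lemma occurs_integral mu n : occurs mu n -> integral_weights mu.
Proof.
move=> [v vP v0] al x y h tr; have [xP yP xy alh _] := tr.
suff [z] : exists z : int, 2%:R * mu h = 2%:R * z%:~R.
  by move/mulfI; rewrite pnatr_eq0 => /(_ isT) ->; exists z.
pose wt b w := exists2 p : hdual hd * Z, W p.1 p.2 w & p.1 h = b.
apply: (@integral_weight F V (X x 0) (X y (- 0)) _ _ 2%:R wt (mu h) v) => //.
- move=> b w [[mu' n'] /= wP <-]; exists (mu' + al, n' + 0); first exact: X_W.
  by rewrite /= add_lfunE alh.
- move=> b w [[mu' n'] /= wP <-]; exists (mu' - al, n' + - 0); first exact: X_W.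
  by rewrite /= add_lfunE opp_lfunE alh.
- move=> b w [[mu' n'] /= wP <-].
  by rewrite X_br xy (X_cartan _ wP) ell0 mulr0 scale0r addr0.
- exact: X_nil (sl2_triple_root tr) xP.
- exact: X_nil (sl2_triple_root (sl2_triple_opp tr)) yP.
- by exists (mu, n).
Qed.

Lemma fin_dim_nilpotent (e : V -> V) (S : set V) : linear e -> locally_nilpotent e ->
  fin_dim S -> exists J, forall v, S v -> iter J e v = 0.
Proof.
move=> eL eN [s sS].
have [J JP] : exists J, forall v, v \in s -> iter J e v = 0.
  elim: (s) => [|w s' [J JP]]; first by exists 0%N.
  have [k kP] := eN w; exists (maxn k J) => v; rewrite inE => /orP[/eqP ->|/JP].
    by apply: iter_zero kP; rewrite // leq_maxl.
  by apply: iter_zero; rewrite // leq_maxr.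
exists J => v /sS; apply: (lspan_min (P := [set v | iter J e v = 0])) => //=.
- exact: linear_zero (iter_linear eL J).
- by move=> a u w u0 w0; rewrite (iter_linear eL J) u0 w0 scaler0 addr0.
Qed.

(** * Upper bounds for the level *)

Definition bounded_level mu : Prop := exists M, forall n, M <= ell n -> ~ occurs mu n.

(** Supplies the inequality of [raise_onto] for all large levels. The threshold is the level of a
    multiple q of p, because q itself serves as a shift later. *)
Lemma ell_large p (z : int) (k : F) : 0 < ell p -> 0 < k ->
  exists q, forall m, ell q <= ell m -> -1 <= z%:~R + k * (ell m)%:~R.
Proof.
move=> p0 k0; have [|n nP] := arch (x := `|z|%:~R / k).
  by rewrite divr_ge0 ?(ltW k0) // ler0z.
exists (p *+ n) => m qm.
have ell_mul j : ell (p *+ j) = ell p *+ j.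
  by elim: j => [|j IHj]; rewrite ?ell0 // !mulrS ellD IHj.
have nm : n%:Z <= ell m.
  have p1 : 1 <= ell p by rewrite -gtz0_ge1.
  by apply: le_trans qm; rewrite ell_mul -natz lerMn2r p1 orbT.
apply: le_trans (_ : - `|z|%:~R + k * n%:R <= _); last first.
  apply: lerD; first by rewrite -mulrNz ler_int; rewrite lerNl -normrN ler_norm.
  by rewrite ler_pM2l // -[n%:R]/(n%:Z%:~R) ler_int.
by rewrite (le_trans (_ : _ <= 0)) ?oppr_le0 ?ler01 // addrC subr_ge0 mulrC -ler_pdivrMr // ltW.
Qed.

Section Bounded.
Variables (al : hdual hd) (x y : g) (h : subvs_of hd) (p : Z).
Hypotheses (tr : sl2_triple al x y h) (p0 : 0 < ell p).

Let k0 : 0 < form x y. Proof. by case: tr => _ _ _ _ []. Qed.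

Lemma integral_weightsD (mu be : hdual hd) k : integral_weights mu -> is_root br be ->
  integral_weights (mu + be *+ k).
Proof.
move=> muint be_root al' x' y' h' tr'; have [z muz] := muint _ _ _ _ tr'.
have [_ _ _ _ [_ _ /(_ be be_root)[z' bez]]] := tr'.
exists (z + z' *+ k); rewrite add_lfunE -scaler_nat scale_lfunE muz bez.
by rewrite intrD rmorphMn /= -[in RHS]mulr_natl.
Qed.

(** From a high occurring (mu, n) one step through -al reaches (mu + al, n0 + q1), and one through
    al then reaches (mu, n0); q1 and q2 make the two steps admissible. *)
Lemma bounded_of_vacant mu n0 : integral_weights mu -> ~ occurs mu n0 -> bounded_level mu.
Proof.
move=> muint nocc; have [z1 z1P] := muint _ _ _ _ tr.
have alint : integral_weights (mu + al) by exact: integral_weightsD 1 muint (sl2_triple_root tr).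
have [z2 z2P] := alint _ _ _ _ (sl2_triple_opp tr).
have [q1 q1P] := ell_large z1 p0 k0; have [q2 q2P] := ell_large z2 p0 k0.
exists (ell n0 + ell q1 + ell q2) => n nM occ_n.
apply: nocc; apply: (occurs_lower (m := q1) tr); first by rewrite z1P q1P.
apply: (occurs_lower (m := n - (n0 + q1)) (sl2_triple_opp tr)).
  by rewrite z2P formC q2P // ellD ellN ellD lerBrDl.
by rewrite addrK addrC subrK.
Qed.

(** A step through -al turns a high occurrence of mu into one of mu + al, with a fixed loss ell(q)
    of level. *)
Lemma bounded_lower mu : integral_weights mu -> bounded_level (mu + al) -> bounded_level mu.
Proof.
move=> muint [M MP].
have alint : integral_weights (mu + al) by exact: integral_weightsD 1 muint (sl2_triple_root tr).
have [z zP] := alint _ _ _ _ (sl2_triple_opp tr); have [q qP] := ell_large z p0 k0.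
exists (M + ell q) => n nM occ_n; apply: (MP (n - q)); first by rewrite ellD ellN lerBrDr.
apply: (occurs_lower (m := q) (sl2_triple_opp tr)); first by rewrite zP formC qP.
by rewrite addrK subrK.
Qed.

Lemma bounded_along_root mu : integral_weights mu -> bounded_level mu.
Proof.
move=> muint; have [z zP] := muint _ _ _ _ tr; have [q qP] := ell_large z p0 k0.
have [xP _ _ alh _] := tr.
have [J JP] := fin_dim_nilpotent (X_linr x q) (X_nil q (sl2_triple_root tr) xP) (W_fin mu 0).
(* The coroot value only grows along the string, so every step is onto; after J steps, with J the
   nilpotency order on [W mu 0], the weight space is zero. *)
have onto i v : W (mu + al *+ i) (q *+ i) v -> exists2 u, W mu 0 u & v = iter i (X x q) u.
  elim: i v => [|i IHi] v; first by rewrite addr0 => vP; exists v.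
  rewrite !mulrSr addrA => /(raise_onto tr)[|w /IHi[u uP ->] ->]; last by exists u.
  rewrite add_lfunE -scaler_nat scale_lfunE alh zP addrAC.
  apply: le_trans (qP _ (lexx _)) _; rewrite lerDl mulr_ge0 ?ler0n //.
have: bounded_level (mu + al *+ J).
  apply: (bounded_of_vacant (n0 := q *+ J)).
    exact: integral_weightsD (sl2_triple_root tr).
  by move=> [v /onto[u /JP -> ->]]; rewrite eqxx.
elim: (J) => [|j IHj]; first by rewrite addr0.
rewrite mulrSr addrA => /bounded_lower bl; apply/IHj/bl.
exact: integral_weightsD (sl2_triple_root tr).
Qed.

End Bounded.

(** A non-integral mu never occurs, and if ell has no positive value the bound 1 is vacuous;
    otherwise some root is available for the descent. *)
Lemma bounded_all mu : bounded_level mu.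
Proof.
have [muint|nint] := pselect (integral_weights mu); last by exists 0 => n _ /occurs_integral.
have [[p p0]|np] := pselect (exists p, 0 < ell p).
  have [al /sl2_triple_exists[x [y [h tr]]]] := root_exists.
  exact: bounded_along_root tr p0 _ muint.
by exists 1 => n n1; case: np; exists n; apply: lt_le_trans n1.
Qed.

Lemma level_bounded : exists M, forall mu n, M <= ell n -> ~ occurs mu n.
Proof.
have [s sP] := finitely_many_minuscule.
have [M MP] : exists M, forall mu, mu \in s -> forall n, M <= ell n -> ~ occurs mu n.
  elim: (s) => [|mu s' [M MP]]; first by exists 0.
  have [M' MP'] := bounded_all mu; exists (Num.max M M') => mu'; rewrite inE => + n.
  rewrite ge_max => /orP[/eqP -> /andP[_ /MP']|/MP + /andP[]] //.
  by move=> MPn /MPn.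
exists M => mu n nM occ_n; have muint := occurs_integral occ_n.
move: mu muint n nM occ_n; apply: (minuscule_descent arch) => [mu muint mumin|].
  exact/MP/sP.
move=> mu al x y h muint al_root tr muh IHmu n nM occ_n; apply: (IHmu n nM).
(* Shift 0 keeps n fixed; mu(h) >= 2 gives (mu - al)(h) >= 0, so the step is admissible. *)
apply: (occurs_lower (m := 0) tr); last by rewrite subrK addr0.
have [_ _ _ alh _] := tr.
rewrite ell0 mulr0 addr0 add_lfunE opp_lfunE alh (le_trans (_ : _ <= 0)) ?subr_ge0 //.
by rewrite oppr_le0 ler01.
Qed.

Lemma top_level_exists : (exists mu n, occurs mu n) ->
  exists n, (exists mu, occurs mu n) /\ forall mu n', ell n < ell n' -> ~ occurs mu n'.
Proof.
have [M MP] := level_bounded; move=> [mu [n occ_n]].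
have [d] : exists d : nat, M - ell n <= d%:Z.
  by exists `|M - ell n|%N; rewrite abszE ler_norm.
elim: d mu n occ_n => [|d IHd] mu n occ_n nd.
  by case: (MP mu n) => //; rewrite -subr_le0.
have [[mu' [n' [nn' occ']]]|top] := pselect (exists mu' n', ell n < ell n' /\ occurs mu' n').
  apply: IHd occ' _; rewrite -ltz1D.
  by apply: lt_le_trans nd; rewrite ltrD2l ltrN2.
exists n; split=> [|mu' n' nn' occ']; first by exists mu.
by apply: top; exists mu', n'.
Qed.

(** * Finiteness of the weights on one level *)

Definition act (s : seq g) (v : V) : V := foldr (fun x => X x 0) v s.

Lemma act_cat s t v : act (s ++ t) v = act s (act t v).
Proof. exact: foldr_cat. Qed.

Lemma act_linear s : linear (act s).
Proof. by elim: s => [|x s IHs] a u v //=; rewrite IHs X_linr. Qed.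

Lemma act_swap s x y t v :
  act (s ++ x :: y :: t) v - act (s ++ y :: x :: t) v = act (s ++ br x y :: t) v.
Proof.
rewrite !act_cat -(linear_sub _ _ (act_linear s)) /=; congr act.
by have := X_br x y 0 (act t v); rewrite oppr0 ell0 mulr0 scale0r addr0.
Qed.

(** The Poincare-Birkhoff-Witt monomials for the list [D]. Under [act] the first block of letters
    acts last. *)
Fixpoint ordered_monomial (D : seq (hdual hd * g)) (t : seq (hdual hd * g)) : Prop :=
  if D is p :: D' then exists k t', t = nseq k p ++ t' /\ ordered_monomial D' t' else t = [::].

Lemma ordered_monomial_perm D t : {subset t <= D} ->
  exists2 t', perm_eq t t' & ordered_monomial D t'.
Proof.
elim: D t => [|p D IHD] t sub.
  by exists [::] => //; case: t sub => // q t /(_ q (mem_head _ _)).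
have [|t' pt mt'] := IHD [seq q <- t | q != p].
  by move=> q; rewrite mem_filter => /andP[/negPf qp /sub]; rewrite inE qp.
exists (nseq (count_mem p t) p ++ t'); last by exists (count_mem p t), t'.
rewrite -(perm_filterC (pred1 p) t) perm_cat //.
have /all_pred1P -> : all (pred1 p) [seq q <- t | pred1 p q] by exact: filter_all.
by rewrite size_filter.
Qed.

Lemma X_nilpotent (al : hdual hd) x m : al != 0 -> root_space br al x -> locally_nilpotent (X x m).
Proof.
move=> al0 xP; have [->|x0] := eqVneq x 0; last first.
  have al_root : is_root br al by split=> //; exists x.
  exact: X_nil al_root xP.
by move=> v; exists 1%N; rewrite /= (linear_zero (@X_linl m v)).
Qed.

(** The later blocks produce finitely many weights. The first block preserves the weight if its root
    is 0; otherwise its letter is nilpotent on these finitely many finite-dimensional spaces, which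
    bounds the exponent. *)
Lemma monomial_weights n (D : seq (hdual hd * g)) (Fs : seq (hdual hd)) :
  {subset D <= E} -> exists Fs' : seq (hdual hd), forall t mu v,
    ordered_monomial D t -> mu \in Fs -> W mu n v ->
    act (map snd t) v = 0 \/ exists2 mu', mu' \in Fs' & W mu' n (act (map snd t) v).
Proof.
elim: D => [|[al x] D IHD] sub.
  by exists Fs => _ mu v -> muF vP; right; exists mu.
have [|Fs1 FsP] := IHD; first by move=> q qD; apply: sub; rewrite inE qD orbT.
have xP : root_space br al x := E_hom (sub (al, x) (mem_head _ _)).
have act_nseq k v : act (map snd (nseq k (al, x))) v = iter k (X x 0) v.
  by elim: k => [|k IHk] //=; rewrite IHk.
have W_iter k mu v : W mu n v -> W (mu + al *+ k) n (iter k (X x 0) v).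
  move=> vP; elim: k => [|k IHk]; first by rewrite addr0.
  by rewrite mulrSr addrA -[n]addr0; apply: X_W.
have [al0|al0] := eqVneq al 0.
  exists Fs1 => _ mu v [k [t' [-> mt']]] muF vP; rewrite map_cat act_cat act_nseq.
  have [-> | [mu' mu'F wP]] := FsP t' mu v mt' muF vP.
    by left; rewrite (linear_zero (iter_linear (X_linr _ _) _)).
  by right; exists mu' => //; have := W_iter k _ _ wP; rewrite al0 mul0rn addr0.
have [J JP] : exists J, forall mu, mu \in Fs1 -> forall v, W mu n v -> iter J (X x 0) v = 0.
  elim: (Fs1) => [|mu s [J JP]]; first by exists 0%N.
  have [J' JP'] := fin_dim_nilpotent (X_linr x 0) (X_nilpotent 0 al0 xP) (W_fin mu n).
  exists (maxn J' J) => mu'; rewrite inE => /orP[/eqP -> v /JP'|/JP JPmu v /JPmu].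
    by apply: iter_zero; rewrite ?leq_maxl.
  by apply: iter_zero; rewrite ?leq_maxr.
exists [seq mu + al *+ j | mu <- Fs1, j <- iota 0 J].
move=> _ mu v [k [t' [-> mt']]] muF vP; rewrite map_cat act_cat act_nseq.
have [-> | [mu' mu'F wP]] := FsP t' mu v mt' muF vP.
  by left; rewrite (linear_zero (iter_linear (X_linr _ _) _)).
have [Jk|kJ] := leqP J k; first by left; apply: iter_zero (JP _ mu'F _ wP).
right; exists (mu' + al *+ k); last exact: W_iter.
by apply: allpairs_f; rewrite // mem_iota.
Qed.

Section WordSpan.
Variables (n : Z) (v : V) (Q : set V).
Hypotheses (Q0 : Q 0) (QL : forall a u w, Q u -> Q w -> Q (a *: u + w)).
Hypothesis Q_mon : forall t, ordered_monomial E t -> Q (act (map snd t) v).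

Let QD u w : Q u -> Q w -> Q (u + w).
Proof. by move=> uQ wQ; rewrite -[u]scale1r; apply: QL. Qed.

(* Modulo shorter words the letters commute, so that every word can be rearranged into an
   ordered monomial: this is the spanning half of the Poincare-Birkhoff-Witt theorem. *)
Lemma word_rearrange d s t r : (forall w, (size w <= d)%N -> Q (act w v)) ->
  perm_eq s t -> (size (r ++ s) <= d.+1)%N -> Q (act (r ++ s) v - act (r ++ t) v).
Proof.
move=> Qd; elim: s t r => [|x s IHs] t r.
  by rewrite perm_sym => /perm_nilP ->; rewrite subrr.
move=> pt size_s; have xt : x \in t by rewrite -(perm_mem pt) mem_head.
have [a [b tE]] : exists a b, t = a ++ x :: b by case/splitPr: xt => a b; exists a, b.
have ps : perm_eq s (a ++ b).
  by move: pt; rewrite tE perm_sym -cat1s perm_catCA perm_cons perm_sym.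
have size_ab : size s = size (a ++ b) := perm_size ps.
have -> : act (r ++ x :: s) v - act (r ++ t) v =
    (act (rcons r x ++ s) v - act (rcons r x ++ a ++ b) v)
    + (act (r ++ x :: a ++ b) v - act (r ++ a ++ x :: b) v).
  by rewrite !cat_rcons tE addrA subrK.
apply: QD; first by apply: IHs; rewrite // cat_rcons.
have: (size (r ++ x :: a ++ b) <= d.+1)%N.
  by move: size_s; rewrite !size_cat /= size_ab size_cat.
elim: (a) (r) => [|y a' IHa] r' size_r'; first by rewrite subrr.
rewrite -(subrK (act (r' ++ y :: x :: a' ++ b) v) (act (r' ++ x :: (y :: a') ++ b) v)).
rewrite -addrA; apply: QD.
  rewrite act_swap; apply: Qd; move: size_r'.
  by rewrite !size_cat /= !addnS ltnS.
have := IHa (rcons r' y); rewrite !cat_rcons; apply; move: size_r'.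
by rewrite !size_cat /= !addnS.
Qed.

(** Induction on the length: the letters are expanded in the spanning list [E], and the resulting
    word is reordered at the cost of shorter words. *)
Lemma words_in_span s : Q (act s v).
Proof.
suff main d w : (size w <= d)%N -> Q (act w v) by apply: (main (size s)).
elim: d w => [|d IHd] w size_w.
  move: size_w; rewrite leqn0 => /nilP ->; apply: (Q_mon (t := [::])).
  by elim: E => [|p D IHD] //=; exists 0%N, [::].
(* The prefix [t] already consists of letters of [E]; the letters of [b] remain to be expanded. *)
have expand b (t : seq (hdual hd * g)) : {subset t <= E} -> (size (map snd t ++ b) <= d.+1)%N ->
    Q (act (map snd t ++ b) v).
  elim: b t => [|x b IHb] t tE size_t.
    rewrite cats0 in size_t *; have [t' pt mt'] := ordered_monomial_perm tE.
    rewrite -(subrK (act (map snd t') v) (act (map snd t) v)); apply: QD; last exact: Q_mon.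
    by apply: (word_rearrange (d := d) (r := [::])); rewrite // perm_map.
  have [c ->] := E_span x; rewrite act_cat /=.
  rewrite (linear_sumE _ _ _ (@X_linl 0 _)) (linear_sumE _ _ _ (act_linear _)) big_seq.
  elim/big_ind: _ => // p pE.
  rewrite (linear_scale _ _ (@X_linl 0 _)) (linear_scale _ _ (act_linear _)).
  rewrite -[_ *: _]addr0; apply: QL => //.
  have := IHb (rcons t p); rewrite map_rcons cat_rcons act_cat /=; apply.
    by move=> q; rewrite mem_rcons inE => /orP[/eqP ->|/tE].
  by move: size_t; rewrite !size_cat.
exact: (expand w [::]).
Qed.

End WordSpan.

(** The vector lies in the sum of the weight spaces produced by ordered monomials, so independence
    of weight vectors leaves no other weight. The list is uniform in the word and in v. *)
Lemma word_weights_finite lam n : exists Fs : seq (hdual hd), forall s v mu,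
  W lam n v -> W mu n (act s v) -> act s v != 0 -> mu \in Fs.
Proof.
have [Fs FsP] := monomial_weights n [:: lam] (D := E) (fun p pE => pE).
exists Fs => s v mu vP uP; apply: contraNT => muF.
pose Q : set V := [set u | exists2 f : hdual hd -> V, forall ga, W ga n (f ga)
  & u = \sum_(ga <- undup Fs) f ga].
have [] : Q (act s v).
  apply: words_in_span => [|a u w [f fW ->] [f' fW' ->]|t mt].
  - by exists (fun=> 0) => //; rewrite big1.
  - exists (fun ga => a *: f ga + f' ga) => [ga|]; first exact: W_lin.
    by rewrite big_split scaler_sumr.
  - have [->|[ga gaF wP]] := FsP t lam v mt (mem_head _ _) vP.
      by exists (fun=> 0) => //; rewrite big1.
    exists (fun be => if be == ga then act (map snd t) v else 0) => [be|].
      by case: eqP => [->|].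
    rewrite (bigD1_seq ga) ?undup_uniq ?mem_undup //= eqxx big1 ?addr0 // => be /negPf -> //.
move=> f fW uE.
apply/eqP; apply: (@joint_eigen_indep F V (subvs_of hd) (fun h => X (vsval h) 0)
  (fun h => X_linr _ _) (hdual hd) (fun ga h => ga h) (undup Fs) f (fun h => mu h) _ _ _ _ uE).
- move=> ga; rewrite mem_undup => gaF; apply: hdual_neq.
  by apply: contraNneq muF => <-.
- by move=> ga _ h; apply: X_cartan (fW ga).
- by move=> h; apply: X_cartan uP.
Qed.

Lemma level_finite nL : exists s : seq (hdual hd), forall mu n,
  ell n = ell nL -> occurs mu n -> mu \in s.
Proof.
have [s sP] := finitely_many_minuscule.
have [Fs FsP] : exists Fs : seq (hdual hd), forall lam, lam \in s -> forall w v mu,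
    W lam nL v -> W mu nL (act w v) -> act w v != 0 -> mu \in Fs.
  elim: (s) => [|lam s' [Fs FsP]]; first by exists [::].
  have [Fs' FsP'] := word_weights_finite lam nL.
  exists (Fs' ++ Fs) => lam'; rewrite inE => /orP[/eqP ->|/FsP lamP] w v mu vP uP u0.
    by rewrite mem_cat (FsP' w v).
  by rewrite mem_cat (lamP w v) ?orbT.
(* This says that [W mu nL] is contained in U(g) [W lam nL]; words use shift 0 only, so both sides
   sit at [nL]. *)
pose gen lam mu := forall u, W mu nL u -> exists w v, W lam nL v /\ u = act w v.
exists (s ++ [seq mu + al | mu <- Fs, al <- map fst E]) => mu n nnL occ_n.
(* As mu may occur at some n other than [nL], the last step of the descent uses the shift n - [nL]
   in ker ell; this places the weight mu' below it at [nL], where generation applies. *)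
suff [lam lams [_ [->|[mu' [al [[alE muE] occ' gen']]]]]] : exists2 lam, lam \in s &
    gen lam mu /\ (mu = lam \/ exists mu' al, [/\ al \in map fst E /\ mu = mu' + al,
      forall n, ell n = ell nL -> occurs mu n -> occurs mu' nL & gen lam mu']).
- by rewrite mem_cat lams.
- have [u uP u0] := occ' n nnL occ_n; have [w [v [vP uE]]] := gen' u uP.
  rewrite muE mem_cat; apply/orP; right; apply: allpairs_f => //.
  by apply: (FsP lam lams w v); rewrite -?uE.
have muint := occurs_integral occ_n; move: mu muint {occ_n}.
apply: (minuscule_descent arch) => [mu muint mumin|].
  exists mu; first exact: sP.
  by split; [move=> u uP; exists [::], u|left].
move=> mu al x y h muint al_root tr muh [lam lams [gen_lam _]]; exists lam => //.
have [_ _ _ alh _] := tr; have [_ [z zP z0]] := al_root.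
have ge1 m : ell m = 0 -> -1 <= (mu - al) h + form x y * (ell m)%:~R.
  move=> ->; rewrite mulr0 addr0 add_lfunE opp_lfunE alh.
  by rewrite (le_trans (_ : _ <= 0)) ?subr_ge0 // oppr_le0 ler01.
split=> [u uP|].
  have [|u' u'P ->] := raise_onto (n := nL) (m := 0) tr (ge1 0 ell0) (v := u).
    by rewrite subrK addr0.
  have [w [v [vP ->]]] := gen_lam u' u'P.
  by exists (x :: w), v.
right; exists (mu - al), al; split=> //.
- by rewrite subrK; split=> //; apply: weight_in_basis zP z0.
- move=> n' nnL' occ_mu; apply: (occurs_lower (m := n' - nL) tr).
    by apply: ge1; rewrite ellD ellN nnL' subrr.
  by rewrite subrK addrC subrK.
Qed.

(** The order of [F] is partial, so maximality only means that no strictly larger value occurs. *)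
Lemma maximal_in_seq (T : eqType) (P : T -> Prop) (f : T -> F) (s : seq T) :
  (exists2 x, x \in s & P x) ->
  exists2 x, P x & forall y, y \in s -> P y -> ~ f x < f y.
Proof.
elim: s => [[//]|a s IHs] ex.
have [Pa|nPa] := pselect (P a); last first.
  have [|x Px xmax] := IHs.
    by have [x] := ex; rewrite inE => /orP[/eqP -> //|xs Px]; exists x.
  by exists x => // y; rewrite inE => /orP[/eqP ->|/xmax].
have [exs|nexs] := pselect (exists2 x, x \in s & P x).
  have [x Px xmax] := IHs exs; have [xa|nxa] := boolP (f x < f a).
    exists a => // y; rewrite inE => /orP[/eqP -> _|ys Py]; first by rewrite ltxx.
    by move=> ay; apply: (xmax y ys Py); apply: lt_trans ay.
  by exists x => // y; rewrite inE => /orP[/eqP -> _|/xmax//]; apply/negP.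
exists a => // y; rewrite inE => /orP[/eqP -> _|ys Py]; first by rewrite ltxx.
by case: nexs; exists y.
Qed.

Lemma extremal_weight (Pos : hdual hd -> Prop) (ht : hdual hd -> F) :
  (forall al be, ht (al + be) = ht al + ht be) -> (forall al, Pos al -> 0 < ht al) ->
  (exists mu n, occurs mu n) ->
  exists mu n, [/\ occurs mu n, forall mu' m, 0 < ell m -> ~ occurs mu' (n + m)
    & forall al m, Pos al -> ell m = 0 -> ~ occurs (mu + al) (n + m)].
Proof.
move=> htD ht_pos /top_level_exists[nL [[mu0 occ0] top]].
have [s sP] := level_finite nL.
pose P mu := exists2 n, ell n = ell nL & occurs mu n.
have [|mu [n nnL occ_n] mumax] := @maximal_in_seq _ P ht s.
  by exists mu0; [apply: sP occ0|exists nL].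
exists mu, n; split=> // [mu' m m0|al m al_pos m0 occ'].
  by apply: top; rewrite ellD nnL ltrDl.
have ell_nm : ell (n + m) = ell nL by rewrite ellD m0 addr0.
apply: (mumax (mu + al)); [exact: sP occ'|by exists (n + m)|].
by rewrite htD ltrDl ht_pos.
Qed.

End LoopModule.

End InvariantForm.

End HomogeneousBasis.

End RootSystem.

(** * Modules over the toroidal algebra *)

Section ToroidalModule.
Context {F : numFieldType} (g : vectType F) (br : g -> g -> g).
Hypothesis arch : forall x : F, 0 <= x -> exists n : nat, x < n%:R.
Hypothesis g_simple : is_simple br.
Context (hd : {vspace g}).
Hypothesis hd_cartan : is_cartan br hd.
Variable form : g -> g -> F^o.
Hypothesis form_inv : is_invariant_form br form.
Hypothesis form_pos : is_positive_form br hd form.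
Context (nu : nat) (mu1 mu2 : F) (B : comAlgType F).
Context (V : lmodType F) (rho : tensor (tau g nu) B -> V -> V).
Hypothesis V_Cfin : in_Cfin br hd rho form mu1 mu2.
Hypothesis V_neq0 : exists v : V, v != 0.
Variable c : 'I_nu.+1 -> int.
Hypothesis c_charges : central_charges hd rho c.

Let br_bilin : bilin br. Proof. by case: g_simple => -[]. Qed.
Let form_bilin : bilin form. Proof. by case: form_inv. Qed.
Let rho_bilin : bilin rho. Proof. by case: V_Cfin => -[]. Qed.

Local Notation tbr := (@tau_br F g nu br form mu1 mu2).

Let tbr_bilin : bilin tbr. Proof. exact: tau_br_bilin. Qed.

Definition op (u : tau g nu) (b : B) (v : V) : V := rho (tens u b) v.

Lemma op_linear u b : linear (op u b). Proof. exact: rho_bilin.2. Qed.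

Lemma op_linearl b v : linear (fun u => op u b v).
Proof. by move=> a x y; rewrite /op (tens_bilin _ _).1 rho_bilin.1. Qed.

Lemma op_gt_linear m b v : linear (fun x => op (gt x m) b v).
Proof. by move=> a x y; rewrite gt_linear op_linearl. Qed.

Lemma op_commute u w b b' v :
  op u b (op w b' v) = op (tbr u w) (b * b') v + op w b' (op u b v).
Proof.
have [[_ rho_br] _ _] := V_Cfin; rewrite /op -(current_br_tens _ _ _ _ tbr_bilin).
by rewrite rho_br subrK.
Qed.

(** The root of u with respect to the Cartan part and the degree derivations d_p: al shifted by the
    null root m. *)
Definition has_weight (u : tau g nu) (al : hdual hd) (m : zlat nu) : Prop :=
  (forall h : subvs_of hd, tbr (gt (vsval h) 0) u = al h *: u) /\
  (forall p, tbr (dt g 0 p) u = (m p)%:~R *: u).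

Lemma gt_weight al x m : root_space br al x -> has_weight (gt x m) al m.
Proof.
move=> xP; split=> [h|p].
  rewrite (tau_br_gg mu1 mu2 br_bilin form_bilin) xP (add0r m).
  rewrite (linear_scale _ _ (@gt_linear _ _ _ _)) big1 => [|p _]; first by rewrite scaler0 addr0.
  by rewrite ffunE scale0r.
by rewrite (tau_br_dg mu1 mu2 br_bilin form_bilin) (add0r m).
Qed.

Lemma kt_weight m q : has_weight (kt g m q) 0 m.
Proof.
split=> [h|p].
  by rewrite (tau_br_gk mu1 mu2 br_bilin form_bilin) zero_lfunE scale0r.
rewrite (tau_br_dk mu1 mu2 br_bilin form_bilin) (add0r m).
rewrite (_ : \sum_i _ = 0) ?scaler0 ?addr0 //.
by apply: big1 => i _; rewrite ffunE scale0r.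
Qed.

Lemma dt_weight m q : has_weight (dt g m q) 0 m.
Proof.
split=> [h|p].
  by rewrite (tau_br_gd mu1 mu2 br_bilin form_bilin) ffunE scale0r oppr0 zero_lfunE scale0r.
rewrite (tau_br_dd mu1 mu2 br_bilin form_bilin) (add0r m).
rewrite (_ : \sum_i _ = 0); last by apply: big1 => i _; rewrite ffunE scale0r.
by rewrite !scaler0 !addr0 ffunE scale0r subr0.
Qed.

(** * Weight spaces of a toroidal module *)

Section WeightSpaces.
Variable z : 'I_nu.+1 -> F.

(** The d_p may have non-integral eigenvalues; the offset [z] comes from a reference weight, and the
    lattice indexes its coset. *)
Definition wspace (mu : hdual hd) (n : zlat nu) : set V :=
  [set v | (forall h : subvs_of hd, op (gt (vsval h) 0) 1 v = mu h *: v)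
        /\ (forall p, op (dt g 0 p) 1 v = (z p + (n p)%:~R) *: v)].

Lemma op_wspace u al m b mu n v :
  has_weight u al m -> wspace mu n v -> wspace (mu + al) (n + m) (op u b v).
Proof.
move=> [uh ud] [vh vd]; split=> [h|p].
  rewrite op_commute uh vh mul1r (linear_scale _ _ (op_linearl _ _)).
  by rewrite (linear_scale _ _ (op_linear _ _)) -scalerDl addrC add_lfunE.
rewrite op_commute ud vd mul1r (linear_scale _ _ (op_linearl _ _)).
by rewrite (linear_scale _ _ (op_linear _ _)) -scalerDl ffunE intrD addrC -addrA.
Qed.

Lemma wspace_lin mu n a u v : wspace mu n u -> wspace mu n v -> wspace mu n (a *: u + v).
Proof.
move=> [uh ud] [vh vd]; split=> [h|p]; rewrite op_linear ?uh ?vh ?ud ?vd;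
  by rewrite scalerDr !scalerA mulrC.
Qed.

Lemma wspace0 mu n : wspace mu n 0.
Proof. by split=> [h|p]; rewrite (linear_zero (op_linear _ _)) scaler0. Qed.

Lemma op_cartan_emb (h : cartan hd nu) v : rho (tens (cartan_emb h) 1) v =
  op (gt (vsval h.1.1) 0) 1 v + \sum_p h.1.2 0 p *: op (kt g 0 p) 1 v
  + \sum_p h.2 0 p *: op (dt g 0 p) 1 v.
Proof.
rewrite -[LHS]/(op (cartan_emb h) 1 v) /cartan_emb.
rewrite !(linear_add _ _ (op_linearl _ _)) !(linear_sumE _ _ _ (op_linearl _ _)).
by congr (_ + _ + _); apply: eq_bigr => p _; rewrite (linear_scale _ _ (op_linearl _ _)).
Qed.

Lemma op_central p v : op (kt g 0 p) 1 v = (c p)%:~R *: v.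
Proof.
have [_ [[wdec _] _] _] := V_Cfin; have [s [f [_ fP ->]]] := wdec v.
rewrite (linear_sumE _ _ _ (op_linear _ _)) scaler_sumr; apply: eq_bigr => lam _.
have [->|f0] := eqVneq (f lam) 0; first by rewrite (linear_zero (op_linear _ _)) scaler0.
rewrite -(c_charges (lam := lam)); last by exists (f lam).
rewrite -(fP lam (cartan_k hd p)) op_cartan_emb.
transitivity (0 + op (kt g 0 p) 1 (f lam) + 0); first by rewrite add0r addr0.
congr (_ + _ + _).
- by rewrite linear0; apply/esym/(linear_zero (op_gt_linear _ _ _)).
- rewrite (bigD1 p) //= !mxE !eqxx scale1r big1 ?addr0 // => q qp.
  by rewrite mxE (negPf qp) andbF scale0r.
- by rewrite big1 // => q _; rewrite mxE scale0r.
Qed.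

(** Since each k_p acts by the scalar c_p, the space lies in one genuine weight space. *)
Lemma wspace_fin_dim mu n : fin_dim (wspace mu n).
Proof.
have [_ _ V_fin] := V_Cfin.
pose lam (h : cartan hd nu) : F^o := mu h.1.1 + \sum_p h.1.2 0 p * (c p)%:~R
  + \sum_p h.2 0 p * (z p + (n p)%:~R).
have lamL : linear lam.
  move=> a [[h1 k1] d1] [[h2 k2] d2]; rewrite /lam /= linearP.
  have sumL (x y : 'rV[F]_nu.+1) (w : 'I_nu.+1 -> F) :
      \sum_p (a *: x + y) 0 p * w p = a * (\sum_p x 0 p * w p) + \sum_p y 0 p * w p.
    rewrite mulr_sumr -big_split; apply: eq_bigr => p _ /=.
    by rewrite !mxE mulrDl -mulrA.
  have alg (x1 x2 x3 y1 y2 y3 : F) : a * x1 + y1 + (a * x2 + y2) + (a * x3 + y3) =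
    a * (x1 + x2 + x3) + (y1 + y2 + y3) by ring.
  by rewrite !sumL; exact: alg.
have [phi phiE] := linear_hom lamL.
have [s sP] := V_fin phi; exists s => v [vh vd]; apply: sP => h.
rewrite phiE op_cartan_emb vh /lam !scalerDl !scaler_suml; congr (_ + _ + _).
  by apply: eq_bigr => p _; rewrite op_central scalerA.
by apply: eq_bigr => p _; rewrite vd scalerA.
Qed.

End WeightSpaces.

(** The scalar by which the central element \sum_p m_p k_p acts; it plays the role of ell. *)
Definition charge_level (m : zlat nu) : int := \sum_p m p * c p.

Lemma gt_bracket x y m v : op (gt x m) 1 (op (gt y (- m)) 1 v) - op (gt y (- m)) 1 (op (gt x m) 1 v)
  = op (gt (br x y) 0) 1 v + (form x y * (charge_level m)%:~R) *: v.
Proof.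
apply/eqP; rewrite subr_eq; apply/eqP; apply: etrans (op_commute _ _ _ _ _) _.
congr (_ + _); rewrite (mulr1 (1 : B)).
rewrite (tau_br_gg mu1 mu2 br_bilin form_bilin) (subrr m).
rewrite (linear_add _ _ (op_linearl 1 v)).
congr (_ + _).
rewrite (linear_scale _ _ (op_linearl 1 v)) -scalerA.
congr (_ *: _).
rewrite (linear_sumE _ _ _ (op_linearl 1 v)).
rewrite rmorph_sum scaler_suml.
apply: eq_bigr => p _.
rewrite (linear_scale _ _ (op_linearl 1 v)) op_central scalerA.
by rewrite rmorphM.
Qed.

(** The weight analysis involves operators u (x) 1 only. As u (x) b shifts weights like u for every
    b, any operator aimed at a vacant weight space kills the vector, including those from K and
    D. *)
Lemma extremal_vector (Pos : hdual hd -> Prop) (ht : hdual hd -> F) :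
  (forall al be, ht (al + be) = ht al + ht be) -> (forall al, Pos al -> 0 < ht al) ->
  exists v : V, [/\ v != 0,
    forall u al m b, has_weight u al m -> 0 < charge_level m -> op u b v = 0
  & forall u al m b, has_weight u al m -> Pos al -> charge_level m = 0 -> op u b v = 0].
Proof.
move=> htD ht_pos; have [_ [[wdec _] V_nil] _] := V_Cfin.
have [lam [v vP v0]] : exists lam : weight hd nu, exists2 v, weight_space rho lam v & v != 0.
  have [v v0] := V_neq0; have [s [f [_ fP vE]]] := wdec v.
  apply: contrapT => nex; case/eqP: v0; rewrite vE big1 // => lam _.
  by apply: contrapT => /eqP f0; apply: nex; exists lam, (f lam).
pose z p := lam (0, 0, delta_mx 0 p).
have [mu muE] : exists mu : hdual hd, forall h, mu h = lam (h, 0, 0).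
  apply: linear_hom => a h h'.
  have -> : (a *: h + h', 0, 0) = a *: ((h, 0, 0) : cartan hd nu) + (h', 0, 0).
    by apply/esym; transitivity (a *: h + h', a *: (0 : 'rV[F]_nu.+1) + 0,
      a *: (0 : 'rV[F]_nu.+1) + 0); rewrite // scaler0 addr0.
  exact: linearP.
have vW : wspace z mu 0 v.
  split=> [h|p].
    rewrite muE -vP op_cartan_emb.
    transitivity (op (gt (vsval h) 0) 1 v + 0 + 0); first by rewrite !addr0.
    by congr (_ + _ + _); rewrite big1 // => p _; rewrite mxE scale0r.
  rewrite ffunE addr0 -vP op_cartan_emb.
  transitivity (0 + 0 + op (dt g 0 p) 1 v); first by rewrite !add0r.
  congr (_ + _ + _).
  - by rewrite linear0; apply/esym/(linear_zero (op_gt_linear _ _ _)).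
  - by rewrite big1 // => q _; rewrite mxE scale0r.
  - rewrite (bigD1 p) //= !mxE !eqxx scale1r big1 ?addr0 // => q qp.
    by rewrite mxE (negPf qp) andbF scale0r.
have [E [_ E_hom E_span]] := homogeneous_basis g_simple hd_cartan.
have levelD m n : charge_level (m + n) = charge_level m + charge_level n.
  by rewrite /charge_level -big_split; apply: eq_bigr => p _; rewrite ffunE mulrDl.
have X_W al x m mu' n w : root_space br al x -> wspace z mu' n w ->
    wspace z (mu' + al) (n + m) (op (gt x m) 1 w).
  by move=> xP; apply: op_wspace; apply: gt_weight.
have X_cartan (h : subvs_of hd) mu' n w : wspace z mu' n w -> op (gt (vsval h) 0) 1 w = mu' h *: w.
  by case.
have X_nil (al : hdual hd) x m : is_root br al -> root_space br al x ->
    locally_nilpotent (op (gt x m) 1) by exact: V_nil.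
have occ0 : exists mu n, occurs (wspace z) mu n by exists mu, 0, v.
have [mu' [n [[w wW w0] top high]]] := extremal_weight g_simple hd_cartan E_hom E_span form_inv
  form_pos arch levelD (fun x m => op_linear (gt x m) 1) (fun m => op_gt_linear m 1)
  (wspace0 z) (wspace_lin (z := z)) (wspace_fin_dim z) X_W X_cartan gt_bracket X_nil
  htD ht_pos occ0.
exists w; split=> // [u al m b uP m_gt0|u al m b uP al_pos m0].
  apply: contrapT => /eqP nz; apply: (top (mu' + al) m m_gt0).
  by exists (op u b w) => //; apply: op_wspace uP wW.
apply: contrapT => /eqP nz; apply: (high al m al_pos m0).
by exists (op u b w) => //; apply: op_wspace uP wW.
Qed.

(** * Annihilation by subalgebras of the current algebra *)

Lemma current_annihilated (S : set (tau g nu)) v :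
  (forall u b, S u -> op u b v = 0) -> annihilated rho (current_sub (lspan S)) v.
Proof.
move=> S0 t; apply: (lspan_min (P := [set t | rho t v = 0])) => /=.
- exact: linear_zero (rho_bilin.1 v).
- by move=> a t1 t2 E1 E2; rewrite rho_bilin.1 E1 E2 scaler0 addr0.
move=> _ [u [b [uS ->]]]; apply: (lspan_min (P := [set u | op u b v = 0])) uS => /=.
- exact: linear_zero (op_linearl b v).
- by move=> a t1 t2 E1 E2; rewrite op_linearl E1 E2 scaler0 addr0.
- by move=> w; apply: S0.
Qed.

Lemma op_gt_span S x m b v : lspan S x -> (forall y, S y -> op (gt y m) b v = 0) ->
  op (gt x m) b v = 0.
Proof.
move=> xS S0; apply: (lspan_min (P := [set x | op (gt x m) b v = 0])) xS => /=.
- exact: (linear_zero (op_gt_linear m b v)).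
- by move=> a t1 t2 E1 E2; rewrite op_gt_linear E1 E2 scaler0 addr0.
- exact: S0.
Qed.

Section Annihilation.
Variables (Pos : hdual hd -> Prop) (ht : hdual hd -> F) (S : set g).
Hypothesis htD : forall al be, ht (al + be) = ht al + ht be.
Hypothesis ht_pos : forall al, Pos al -> 0 < ht al.
Hypothesis S_root : forall x, S x -> exists2 al, Pos al & root_space br al x.

(** The level of m is m_0 c_0: it is positive on the chosen half, and zero for m_0 = 0, where the
    root lies in [Pos]. *)
Lemma tau_half_vector (half : pred int) :
  (forall p, p != ord0 -> c p = 0) -> (forall i, half i -> 0 < i * c ord0) ->
  exists2 v : V, v != 0 & annihilated rho (current_sub (tau_half (lspan S) half)) v.
Proof.
move=> c0 half_pos; have [v [v0 top high]] := extremal_vector htD ht_pos.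
have levelE m : charge_level m = m ord0 * c ord0.
  by rewrite /charge_level (bigD1 ord0) //= big1 ?addr0 // => p /c0 ->; rewrite mulr0.
exists v => //; apply: current_annihilated => u b.
move=> [[x [m [xS m0 ->]]]|[x [m [hm ->]]]|[m [p [hm ->]]]|[m [p [hm ->]]]].
- apply: (op_gt_span xS) => y /S_root[al al_pos yP].
  by apply: high (gt_weight m yP) al_pos _; rewrite levelE m0 mul0r.
(* All of [g] occurs here, so x is split into root vectors of any root, 0 included; positivity of
   the level suffices. *)
- apply: (op_gt_span (root_decomposition g_simple hd_cartan x)) => y [al yP].
  by apply: top (gt_weight m yP) _; rewrite levelE half_pos.
- by apply: top (kt_weight m p) _; rewrite levelE half_pos.
- by apply: top (dt_weight m p) _; rewrite levelE half_pos.
Qed.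

(** With vanishing charges every shift has level 0, so a positive root is excluded at all degrees of
    A. *)
Lemma loop_vector : (forall p, c p = 0) ->
  exists2 v : V, v != 0 & annihilated rho (current_sub (loop_sub (lspan S))) v.
Proof.
move=> c0; have [v [v0 _ high]] := extremal_vector htD ht_pos.
exists v => //; apply: current_annihilated => _ b [x [f [xS ->]]].
have [_ gAr] := @gA_bilin F g nu.
have opL : linear (fun f => op (gA x f) b v) by move=> a f1 f2; rewrite gAr op_linearl.
have gt0 m : op (gt x m) b v = 0.
  apply: (op_gt_span xS) => y /S_root[al al_pos yP].
  apply: high (gt_weight m yP) al_pos _.
  by rewrite /charge_level big1 // => p _; rewrite c0 mulr0.
apply: (malg_ind (P := fun f => op (gA x f) b v = 0)) f => [|a f1 f2 E1 E2|m].
- exact: (linear_zero opL).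
- apply: etrans (opL a f1 f2) _; apply: etrans (_ : a *: 0 + 0 = 0).
    exact: congr2 (congr1 _ E1) E2.
  by rewrite scaler0 addr0.
- exact: gt0.
Qed.

End Annihilation.

End ToroidalModule.

(** * Heights of roots *)

Section Height.
Context {F : numFieldType} (g : vectType F) (br : g -> g -> g) (hd : {vspace g}).
Variable Pi : seq (hdual hd).
Hypothesis Pi_base : is_base br Pi.

(** Defined on the whole dual, because it also compares weights of the module; its values are then
    general scalars. *)
Definition height (al : hdual hd) : F := \sum_(i < size Pi) coord (in_tuple Pi) i al.

Lemma heightD al be : height (al + be) = height al + height be.
Proof. by rewrite /height -big_split; apply: eq_bigr => i _; rewrite linearD. Qed.

Lemma heightN al : height (- al) = - height al.
Proof. by rewrite /height -sumrN; apply: eq_bigr => i _; rewrite linearN. Qed.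

Lemma height_gt0 al : al != 0 -> nat_comb Pi al -> 0 < height al.
Proof.
move=> al0 [k alE]; have [Pi_free _ _] := Pi_base.
pose n (i : 'I_(size Pi)) : nat := k (nth 0 Pi i).
have alE' : al = \sum_(i < size Pi) (n i)%:R *: nth 0 Pi i.
  by rewrite alE (big_nth 0) big_mkord; apply: eq_bigr => i _; rewrite scaler_nat.
have coordE (i : 'I_(size Pi)) : coord (in_tuple Pi) i al = (n i)%:R.
  by rewrite alE'; apply: (coord_sum_free (X := in_tuple Pi) (fun i => (n i)%:R)).
have htE : height al = (\sum_i n i)%:R.
  by rewrite natr_sum; apply: eq_bigr => i _.
rewrite htE ltr0n lt0n sum_nat_eq0; apply: contra al0 => /forallP k0.
by rewrite alE'; apply/eqP/big1 => i _; have /eqP -> := k0 i; rewrite scale0r.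
Qed.

End Height.

(** In the order of [R[i]] a nonnegative element is real. *)
Lemma complex_archimedean (R : realType) (x : R[i]) : 0 <= x -> exists n : nat, x < n%:R.
Proof.
case: x => a b; rewrite lecE /= => /andP[/eqP b0 a0]; exists (Num.bound a).
rewrite ltcE /=.
have natE n : n%:R = real_complex R n%:R by rewrite rmorph_nat.
by rewrite natE /= b0 eqxx archi_boundP.
Qed.

(** * The three sign cases over the complex numbers *)

Theorem theorem3p4 (R : realType)
    (g : vectType R[i]) (br : g -> g -> g) (g_simple : is_simple br)
    (hd : {vspace g}) (hd_cartan : is_cartan br hd)
    (Pi : seq (hdual hd)) (Pi_base : is_base br Pi)
    (form : g -> g -> (R[i])^o) (form_inv : is_invariant_form br form)
    (form_pos : is_positive_form br hd form)
    (nu : nat) (nu_gt0 : (0 < nu)%N) (mu1 mu2 : R[i])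
    (B : comAlgType R[i]) (B_fg : fin_gen B)
    (V : lmodType R[i]) (rho : tensor (tau g nu) B -> V -> V)
    (V_Cfin : in_Cfin br hd rho form mu1 mu2)
    (V_neq0 : exists v : V, v != 0)
    (c : 'I_nu.+1 -> int) (c_charges : central_charges hd rho c) :
  [/\ 0 < c ord0 -> (forall p, p != ord0 -> c p = 0) ->
        exists2 v : V, v != 0 &
          annihilated rho (current_sub (tau_plus (g_plus br Pi))) v,
      c ord0 < 0 -> (forall p, p != ord0 -> c p = 0) ->
        exists2 v : V, v != 0 &
          annihilated rho (current_sub (tau_minus (g_minus br Pi))) v
    & (forall p, c p = 0) ->
        exists v w : V,
          [/\ v != 0, w != 0,
              annihilated rho (current_sub (loop_sub (g_plus br Pi))) v
            & annihilated rho (current_sub (loop_sub (g_minus br Pi))) w]].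
Proof.
have arch := @complex_archimedean R.
pose pos := [set al : hdual hd | is_root br al /\ nat_comb Pi al].
pose neg := [set al : hdual hd | is_root br al /\ nat_comb Pi (- al)].
have htD : forall al be : hdual hd, height Pi (al + be) = height Pi al + height Pi be.
  exact: heightD.
(* The negated height is the additive function that is positive on negative roots. *)
have htND al be : - height Pi (al + be) = - height Pi al - height Pi be by rewrite htD opprD.
have pos_gt0 al : pos al -> 0 < height Pi al by case=> -[al0 _]; apply: (height_gt0 Pi_base).
have neg_gt0 al : neg al -> 0 < - height Pi al.
  by case=> -[al0 _] alN; rewrite -heightN; apply: (height_gt0 Pi_base) alN; rewrite oppr_eq0.
have plus_root x :
    (exists al : hdual hd, [/\ is_root br al, nat_comb Pi al & root_space br al x]) ->
    exists2 al, pos al & root_space br al x by case=> al [al1 al2 al3]; exists al.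
have minus_root x :
    (exists al : hdual hd, [/\ is_root br al, nat_comb Pi (- al) & root_space br al x]) ->
    exists2 al, neg al & root_space br al x by case=> al [al1 al2 al3]; exists al.
split=> [c_gt0 c0|c_lt0 c0|c0].
- apply: (tau_half_vector arch g_simple hd_cartan form_inv form_pos V_Cfin V_neq0 c_charges
    htD pos_gt0 plus_root c0) => i i0; exact: mulr_gt0.
- apply: (tau_half_vector arch g_simple hd_cartan form_inv form_pos V_Cfin V_neq0 c_charges
    htND neg_gt0 minus_root c0) => i i0; rewrite nmulr_rgt0 //.
- have [v v0 vP] := loop_vector arch g_simple hd_cartan form_inv form_pos V_Cfin V_neq0 c_charges
    htD pos_gt0 plus_root c0.
  have [w w0 wP] := loop_vector arch g_simple hd_cartan form_inv form_pos V_Cfin V_neq0 c_charges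
    htND neg_gt0 minus_root c0.
  by exists v, w.
Qed.
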